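(* Let $\psi\in\mathrm{Conv}_{\rm c}(\mathbb{R}^n)$. Choose unit vectors $u_1,\dots,u_m\in\mathbb{S}^{n-1}$ such that the closed subgroup of $\mathrm{O}(n)$ generated by the reflections $R_{u_1},\dots,R_{u_m}$ is all of $\mathrm{O}(n)$. Define a cyclic sequence $\{\psi_k\}_{k\ge 0}\subset\mathrm{Conv}_{\rm c}(\mathbb{R}^n)$ by $$\psi_0:=\psi,\qquad \psi_{k+1}:=\tau_{u_{((k \bmod m)+1)}}\psi_k\quad\text{for }k\ge 0.$$ Then there exists a unique radial function $\psi_{\rm sym}\in\mathrm{Conv}_{\rm c}(\mathbb{R}^n)$ such that $$\mathcal{L}\psi_{\rm sym}(x)=\int_{\mathrm{O}(n)}\mathcal{L}\psi(\vartheta^{-1}x)\,d\eta(\vartheta),\qquad x\in\mathbb{R}^n,$$ where $\eta$ denotes the Haar probability measure on $\mathrm{O}(n)$, and $\psi_k$ epi-converges to $\psi_{\rm sym}$ as $k\to\infty$.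
   Context: $\mathrm{Conv}_{\rm c}(\mathbb{R}^n)$ is the set of functions $\psi:\mathbb{R}^n\to(-\infty,+\infty]$ that are convex, lower semicontinuous, proper (not identically $+\infty$) and coercive ($\lim_{|x|\to\infty}\psi(x)=+\infty$). For $u\in\mathbb{S}^{n-1}$, $R_u(x)=x-2\langle x,u\rangle u$ is the reflection about the hyperplane $u^\perp$. The Minkowski symmetral of $\psi\in\mathrm{Conv}_{\rm c}(\mathbb{R}^n)$ is $$\tau_u\psi(x)=\inf_{y+z=x}\left\{\tfrac12\psi(2y)+\tfrac12\psi(R_u(2z))\right\},$$ and it again belongs to $\mathrm{Conv}_{\rm c}(\mathbb{R}^n)$. $\mathcal{L}\psi(x)=\sup_{y\in\mathbb{R}^n}(\langle x,y\rangle-\psi(y))$ is the Legendre--Fenchel transform. A function $g$ is radial if $g\circ\rho=g$ for all $\rho\in\mathrm{O}(n)$. A sequence $\psi_k$ epi-converges to $\psi$ if for every $x\in\mathbb{R}^n$: (i) $\psi(x)\le\liminf_{k}\psi_k(x_k)$ for every sequence $x_k\to x$; and (ii) $\psi(x)=\lim_{k}\psi_k(x_k)$ for at least one sequence $x_k\to x$. *)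

(* Defs.v *)
From HB Require Import structures.
From mathcomp Require Import all_boot all_order all_algebra.
From mathcomp Require Import all_classical all_reals all_analysis.

Set Implicit Arguments.
Unset Strict Implicit.
Unset Printing Implicit Defensive.

Import Order.TTheory GRing.Theory Num.Theory.
Import numFieldNormedType.Exports.

Local Open Scope classical_set_scope.
Local Open Scope ring_scope.

Section Euclidean.
Context {R : realType} {n : nat}.
Implicit Types (x y u : 'cV[R]_n) (A B : 'M[R]_n).

Definition dot x y : R := \sum_(i < n) x i 0 * y i 0.

(* The norm that the library puts on 'cV[R]_n is the sup norm. *)
Definition enorm x : R := Num.sqrt (dot x x).

Definition orthogonal_group : set 'M[R]_n := [set A | A *m A^T = 1%:M].

Definition refl u x : 'cV[R]_n := x - (2 * dot x u) *: u.

Definition refl_mx u : 'M[R]_n := 1%:M - 2 *: (u *m u^T).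

Lemma refl_mxE u x : refl_mx u *m x = refl u x.
Proof.
rewrite /refl_mx /refl mulmxBl mul1mx -scalemxAl -mulmxA.
have -> : u^T *m x = (dot x u)%:M.
  apply/matrixP => i j; rewrite !mxE !ord1 eqxx mulr1n /dot.
  by apply: eq_bigr => k _; rewrite mxE mulrC.
by rewrite mul_mx_scalar scalerA.
Qed.

Definition closed_subgroup (G : set 'M[R]_n) : Prop :=
  [/\ G `<=` orthogonal_group, G 1%:M,
      (forall A B, G A -> G B -> G (A *m B)),
      (forall A, G A -> G (invmx A)) & closed G].

Definition closed_subgroup_generated (S : set 'M[R]_n) : set 'M[R]_n :=
  smallest closed_subgroup S.

End Euclidean.

Definition borel_matrix (R : realType) (n : nat) :=
  g_sigma_algebraType (@open 'M[R]_n).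

(* A Borel probability measure on O(n) is encoded as a Borel probability
   measure on 'M[R]_n giving mass 1 to the closed set O(n); such a measure is
   the Haar measure when it is invariant under left translations by O(n). *)
Definition haar_probability (R : realType) (n : nat)
    (eta : probability (borel_matrix R n) R) : Prop :=
  eta orthogonal_group = 1%E /\
  (forall t : 'M[R]_n, orthogonal_group t ->
   forall S : set (borel_matrix R n), measurable S ->
     eta [set t *m A | A in S] = eta S).

Section ConvexFunctions.
Context {R : realType} {n : nat}.
Implicit Types (psi g : 'cV[R]_n -> \bar R) (x y z u : 'cV[R]_n).
Local Open Scope ereal_scope.

Definition econvex psi : Prop :=
  forall x y (t : R), (0 <= t <= 1)%R ->
    psi (t *: x + (1 - t) *: y)%R <= t%:E * psi x + (1 - t)%:E * psi y.

Definition proper psi : Prop := exists x, psi x != +oo.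

Definition coercive psi : Prop :=
  forall M : R, exists r : R, forall x, (r < enorm x)%R -> M%:E < psi x.

(* Codomain (-oo, +oo]: the value -oo is excluded explicitly. *)
Definition Conv_c : set ('cV[R]_n -> \bar R) :=
  [set psi | [/\ (forall x, -oo < psi x), econvex psi,
                 lower_semicontinuous psi, proper psi & coercive psi]].

Definition minkowski_symmetral u psi x : \bar R :=
  ereal_inf [set (2^-1)%:E * psi (2 *: p.1)%R
                 + (2^-1)%:E * psi (refl u (2 *: p.2))%R
            | p in [set p : 'cV[R]_n * 'cV[R]_n | (p.1 + p.2)%R = x]].

Definition legendre psi x : \bar R :=
  ereal_sup [set (dot x y)%:E - psi y | y in setT].

Definition radial g : Prop :=
  forall rho : 'M[R]_n, orthogonal_group rho -> g \o mulmx rho = g.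

Definition epi_converges (psi_ : nat -> 'cV[R]_n -> \bar R) psi : Prop :=
  forall x,
    (forall x_ : nat -> 'cV[R]_n, x_ @ \oo --> x ->
       psi x <= limn_einf (fun k => psi_ k (x_ k))) /\
    (exists2 x_ : nat -> 'cV[R]_n, x_ @ \oo --> x &
       psi_ k (x_ k) @[k --> \oo] --> psi x).

End ConvexFunctions.

(* Main.v *)
Require Import Defs.
From HB Require Import structures.
From mathcomp Require Import all_boot all_order all_algebra.
From mathcomp Require Import all_classical all_reals all_analysis.
From mathcomp Require Import measurable_realfun ring lra.

Set Implicit Arguments.
Unset Strict Implicit.
Unset Printing Implicit Defensive.

Import Order.TTheory GRing.Theory Num.Theory.
Import numFieldNormedType.Exports.

Local Open Scope classical_set_scope.
Local Open Scope ring_scope.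

(* Conjugation turns the Minkowski symmetral in direction [u] into the average
   of the conjugate with its reflection, so the conjugates of the iterates are
   random-walk averages of [legendre psi] over the reflections. Replacing
   [legendre psi] by the Lipschitz conjugates [f^N] of [psi] restricted to balls,
   these averages contract: words in the reflections are dense in O(n), uniformly
   by compactness, so each block of steps shrinks the oscillation by a fixed
   factor. The limit is the Haar mean of [f^N] because left and right averaging
   commute, and the Haar mean [F] of [legendre psi] is the supremum over [N] by
   monotone convergence. The limit function is the conjugate of [F].
   Epi-convergence is then checked directly. For the lower bound, finiteness of
   [F] at [y] bounds [legendre psi] on the balls of radius less than [|y|], where
   it coincides with some [f^N], and Fenchel-Young applies. For recovery
   sequences, the minimizer of [psi_ k + l * |. - x|^2] carries an explicit dual
   certificate, which also yields the Fenchel-Moreau theorem without any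
   separation argument. *)

(** * Euclidean space and orthogonal matrices *)

(** The obstacle is that [legendre psi] may be [+oo]: coercivity only gives linear growth, hence
    finiteness near the origin. If it is infinite in a null set of directions of a sphere, the Haar
    mean there may be finite while averages along words are [+oo] from some time on, so the
    conjugates need not converge pointwise. Truncation removes the infinities but adds a limit in
    the radius, which need not commute with the limit along the iteration. The exchange is recovered
    after shrinking a dual point [y] to [t y] with [t < 1]; this is harmless, since a radial convex
    mean does not increase under shrinking and [t] may be taken close to 1. All iterates keep the
    growth constants [s], [b] and a point of value at most [a] in a fixed ball, so compactness
    arguments are uniform in the step. *)

Section EuclideanFacts.
Context {R : realType} {n : nat}.
Implicit Types (x y z : 'cV[R]_n) (A : 'M[R]_n).

Lemma dotC x y : dot x y = dot y x.
Proof. by apply: eq_bigr => i _; rewrite mulrC. Qed.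

Lemma dotDl x y z : dot (x + y) z = dot x z + dot y z.
Proof. by rewrite /dot -big_split; apply: eq_bigr => i _; rewrite mxE mulrDl. Qed.

Lemma dotDr x y z : dot x (y + z) = dot x y + dot x z.
Proof. by rewrite dotC dotDl !(dotC x). Qed.

Lemma dotZl a x y : dot (a *: x) y = a * dot x y.
Proof. by rewrite /dot mulr_sumr; apply: eq_bigr => i _; rewrite mxE mulrA. Qed.

Lemma dotZr a x y : dot x (a *: y) = a * dot x y.
Proof. by rewrite dotC dotZl dotC. Qed.

Lemma dotNl x y : dot (- x) y = - dot x y.
Proof. by rewrite -scaleN1r dotZl mulN1r. Qed.

Lemma dotNr x y : dot x (- y) = - dot x y.
Proof. by rewrite dotC dotNl dotC. Qed.

Lemma dotBl x y z : dot (x - y) z = dot x z - dot y z.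
Proof. by rewrite dotDl dotNl. Qed.

Lemma dotBr x y z : dot x (y - z) = dot x y - dot x z.
Proof. by rewrite dotDr dotNr. Qed.

Lemma dot0l x : dot 0 x = 0.
Proof. by rewrite -(scale0r x) dotZl mul0r. Qed.

Lemma dot_mulmxl A x y : dot (A *m x) y = dot x (A^T *m y).
Proof.
have dotE u v : u^T *m v = (dot u v)%:M.
  apply/matrixP => i j; rewrite !mxE !ord1 eqxx mulr1n.
  by apply: eq_bigr => k _; rewrite mxE.
have /matrixP/(_ 0 0) : (dot (A *m x) y)%:M = (dot x (A^T *m y))%:M :> 'M[R]_1.
  by rewrite -!dotE trmx_mul mulmxA.
by rewrite !mxE eqxx !mulr1n.
Qed.

Lemma dot_ge0 x : 0 <= dot x x.
Proof. by apply: sumr_ge0 => i _; rewrite -expr2 sqr_ge0. Qed.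

Lemma sqr_enorm x : enorm x ^+ 2 = dot x x.
Proof. by rewrite sqr_sqrtr ?dot_ge0. Qed.

Lemma enorm_ge0 x : 0 <= enorm x.
Proof. exact: sqrtr_ge0. Qed.

Lemma enorm0 : enorm (0 : 'cV[R]_n) = 0.
Proof. by rewrite /enorm dot0l sqrtr0. Qed.

Lemma ler_coord_enorm x i : `|x i 0| <= enorm x.
Proof.
rewrite -(@ler_pXn2r _ 2) ?nnegrE ?enorm_ge0// sqr_enorm real_normK ?num_real//.
rewrite /dot (bigD1 i)//= expr2 lerDl; apply: sumr_ge0 => j _.
by rewrite -expr2 sqr_ge0.
Qed.

Lemma enorm_eq0 x : enorm x = 0 -> x = 0.
Proof.
move=> x0; apply/colP => i; rewrite mxE; apply/eqP; rewrite -normr_le0 -x0.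
exact: ler_coord_enorm.
Qed.

Lemma Cauchy_Schwarz x y : dot x y <= enorm x * enorm y.
Proof.
have [/enorm_eq0 ->|y0] := eqVneq (enorm y) 0.
  by rewrite dotC dot0l enorm0 mulr0.
have {}y0 : 0 < enorm y by rewrite lt0r y0 enorm_ge0.
have [/enorm_eq0 ->|x0] := eqVneq (enorm x) 0.
  by rewrite dot0l enorm0 mul0r.
have {}x0 : 0 < enorm x by rewrite lt0r x0 enorm_ge0.
have := dot_ge0 (enorm y *: x - enorm x *: y).
rewrite dotBl !dotBr !dotZl !dotZr -!sqr_enorm (dotC y x) => h.
have : 0 <= (2 * (enorm x * enorm y)) * (enorm x * enorm y - dot x y).
  by apply: le_trans h _; nra.
by rewrite pmulr_rge0 ?subr_ge0// !mulr_gt0.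
Qed.

Lemma enormZ a x : enorm (a *: x) = `|a| * enorm x.
Proof. by rewrite /enorm dotZl dotZr mulrA -expr2 sqrtrM ?sqr_ge0// sqrtr_sqr. Qed.

Lemma enormN x : enorm (- x) = enorm x.
Proof. by rewrite -scaleN1r enormZ normrN1 mul1r. Qed.

Lemma ler_enormD x y : enorm (x + y) <= enorm x + enorm y.
Proof.
rewrite -(@ler_pXn2r _ 2) ?nnegrE ?addr_ge0 ?enorm_ge0// sqr_enorm.
rewrite dotDl !dotDr (dotC y x) -!sqr_enorm.
by have := Cauchy_Schwarz x y; nra.
Qed.

Lemma enorm_le_sum x : enorm x <= \sum_i `|x i 0|.
Proof.
have s0 : 0 <= \sum_i `|x i 0| by apply: sumr_ge0.
rewrite -(@ler_pXn2r _ 2) ?nnegrE ?enorm_ge0// sqr_enorm expr2 mulr_suml.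
apply: ler_sum => i _; apply: (le_trans (ler_norm _)); rewrite normrM.
by rewrite ler_wpM2l// (bigD1 i)//= lerDl; apply: sumr_ge0.
Qed.

Lemma enorm_orthogonal A x : orthogonal_group A -> enorm (A *m x) = enorm x.
Proof. by move=> /mulmx1C AA; rewrite /enorm dot_mulmxl mulmxA AA mul1mx. Qed.

Lemma orthogonal1 : orthogonal_group (1%:M : 'M[R]_n).
Proof. by rewrite /orthogonal_group /= trmx1 mulmx1. Qed.

Lemma orthogonalM A B : orthogonal_group A -> orthogonal_group B ->
  orthogonal_group (A *m B).
Proof.
rewrite /orthogonal_group /= => oA oB.
by rewrite trmx_mul mulmxA -(mulmxA A) oB mulmx1 oA.
Qed.

Lemma orthogonal_tr A : orthogonal_group A -> orthogonal_group A^T.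
Proof. by rewrite /orthogonal_group /= trmxK => /mulmx1C. Qed.

Lemma invmx_orthogonal A : orthogonal_group A -> invmx A = A^T.
Proof.
move=> oA; have [Au _] := mulmx1_unit oA.
by rewrite -[RHS](mulKmx Au) oA mulmx1.
Qed.

Lemma refl_mx_tr (u : 'cV[R]_n) : (refl_mx u)^T = refl_mx u.
Proof. by rewrite /refl_mx linearB linearZ /= trmx1 trmx_mul trmxK. Qed.

Lemma refl_mxK (u : 'cV[R]_n) : enorm u = 1 -> refl_mx u *m refl_mx u = 1%:M.
Proof.
move=> u1; have uu : u^T *m u = 1%:M.
  apply/matrixP => i j; rewrite !mxE !ord1 eqxx mulr1n -(expr1n _ 2) -u1 sqr_enorm.
  by apply: eq_bigr => k _; rewrite mxE.
have PP : (u *m u^T) *m (u *m u^T) = u *m u^T.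
  by rewrite -mulmxA (mulmxA _ u) uu mul1mx.
rewrite /refl_mx mulmxBl mul1mx mulmxBr mulmx1 -scalemxAr -scalemxAl PP.
by apply/matrixP => i j; rewrite !mxE; ring.
Qed.

Lemma orthogonal_refl (u : 'cV[R]_n) : enorm u = 1 -> orthogonal_group (refl_mx u).
Proof. by move=> u1; rewrite /orthogonal_group /= refl_mx_tr refl_mxK. Qed.

(** Points of equal norm are exchanged by the reflection in the direction [y - q], because
    [2 <y, y - q> = |y - q|^2]; for [y = q] there is no such direction. *)
Lemma orthogonal_transitive (y q : 'cV[R]_n) : enorm y = enorm q ->
  exists2 A, orthogonal_group A & A *m y = q.
Proof.
move=> yq; have [<-|ynq] := eqVneq y q.
  by exists 1%:M; [exact: orthogonal1|rewrite mul1mx].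
have d0 : 0 < enorm (y - q).
  rewrite lt0r enorm_ge0 andbT; apply: contra_neq ynq => /enorm_eq0/eqP.
  by rewrite subr_eq0 => /eqP.
pose w := (enorm (y - q))^-1 *: (y - q).
exists (refl_mx w).
  apply: orthogonal_refl; rewrite enormZ ger0_norm ?invr_ge0 ?enorm_ge0//.
  by rewrite mulVf// gt_eqF.
rewrite refl_mxE /refl dotZr scalerA.
have -> : 2 * ((enorm (y - q))^-1 * dot y (y - q)) * (enorm (y - q))^-1 = 1.
  have d2 : enorm (y - q) ^+ 2 = 2 * dot y (y - q).
    rewrite sqr_enorm dotBl !dotBr -!sqr_enorm yq (dotC q y); ring.
  have -> : 2 * ((enorm (y - q))^-1 * dot y (y - q)) * (enorm (y - q))^-1 =
    (2 * dot y (y - q)) / enorm (y - q) ^+ 2 by field; rewrite gt_eqF.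
  by rewrite -d2 divff// expf_neq0// gt_eqF.
by rewrite scale1r opprB addrC subrK.
Qed.

End EuclideanFacts.

Section MatrixTopology.
Context {R : realType}.

Lemma sum_continuous {T : topologicalType} p (f : 'I_p -> T -> R) :
  (forall i, continuous (f i)) -> continuous (fun x => \sum_i f i x).
Proof. by move=> fc; apply: continuous_big => // z; exact: (@add_continuous R z). Qed.

Lemma mulr_continuous {T : topologicalType} (f g : T -> R) :
  continuous f -> continuous g -> continuous (fun x => f x * g x).
Proof. by move=> fc gc x; apply: cvgM; [exact: fc|exact: gc]. Qed.

Lemma ler_coord_norm {p q} (M : 'M[R]_(p, q)) i j : `|M i j| <= `|M|.
Proof.
rewrite [leRHS]/Num.norm /= mx_normrE.
exact: (@le_bigmax _ _ _ _ (fun ij : 'I_p * 'I_q => `|M ij.1 ij.2|) (i, j)).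
Qed.

Lemma mx_continuous {T : topologicalType} {p q} (f : T -> 'M[R]_(p, q)) :
  (forall i j, continuous (fun x => f x i j)) -> continuous f.
Proof.
move=> fc x A /= [P Px PA].
have : \forall y \near x, forall i j, P i j (f y i j).
  apply: filter_forall => i; apply: filter_forall => j.
  exact: (fc i j x _ (Px i j)).
by apply: filterS => y Py; exact: PA.
Qed.

Lemma bounded_closed_mx_compact {p q} (A : set 'M[R]_(p, q)) (M : R) :
  (forall B, A B -> `|B| <= M) -> closed A -> compact A.
Proof.
move=> Ab Ac.
have vc : continuous (@vec_mx R p q).
  apply: mx_continuous => i j v.
  have -> : (fun x : 'rV[R]_(p * q) => vec_mx x i j) =
      (fun x => x 0 (mxvec_index i j)).
    by apply/funext => x; rewrite -[in RHS](vec_mxK x) mxvecE.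
  exact: coord_continuous.
have -> : A = vec_mx @` (vec_mx @^-1` A).
  apply/seteqP; split=> [B AB|_ [v /= Av <-]//].
  by exists (mxvec B); rewrite /= mxvecK.
apply: continuous_compact; first exact: continuous_subspaceT.
apply: bounded_closed_compact; last exact: (preimage_closed (fun x _ => vc x)).
exists M; split; first exact: num_real.
move=> N MN v /= Av; apply: le_trans (ltW MN).
apply: le_trans (Ab _ Av).
rewrite [leLHS]/Num.norm /= mx_normrE; apply/bigmax_leP; split=> // -[i k] _ /=.
rewrite ord1 -(vec_mxK v); case/mxvec_indexP: k => a b.
by rewrite mxvecE vec_mxK; exact: ler_coord_norm.
Qed.

Lemma mulmx_continuousl {p q r} (M : 'M[R]_(p, q)) :
  continuous (fun A : 'M[R]_(q, r) => M *m A).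
Proof.
apply: mx_continuous => i j; under eq_fun do rewrite mxE.
apply: sum_continuous => k; apply: mulr_continuous.
  exact: cst_continuous.
exact: coord_continuous.
Qed.

Lemma mulmx_continuousr {p q r} (M : 'M[R]_(q, r)) :
  continuous (fun A : 'M[R]_(p, q) => A *m M).
Proof.
apply: mx_continuous => i j; under eq_fun do rewrite mxE.
apply: sum_continuous => k; apply: mulr_continuous.
  exact: coord_continuous.
exact: cst_continuous.
Qed.

Lemma addmx_continuous {T : topologicalType} {p q} (f g : T -> 'M[R]_(p, q)) :
  continuous f -> continuous g -> continuous (fun x => f x + g x).
Proof. by move=> fc gc x; exact: cvgD (fc x) (gc x). Qed.

Lemma trmx_continuous {p q} : continuous (@trmx R p q).
Proof.
apply: mx_continuous => i j A; under eq_fun do rewrite mxE.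
exact: coord_continuous.
Qed.

Context {n : nat}.

Lemma closed_orthogonal : closed (@orthogonal_group R n).
Proof.
have c : continuous (fun A : 'M[R]_n => A *m A^T).
  apply: mx_continuous => i j.
  have -> : (fun A : 'M[R]_n => (A *m A^T) i j) = (fun A => \sum_k A i k * A j k).
    by apply/funext => A; rewrite mxE; apply: eq_bigr => k _; rewrite mxE.
  by apply: sum_continuous => k; apply: mulr_continuous; exact: coord_continuous.
have -> : orthogonal_group = (fun A : 'M[R]_n => A *m A^T) @^-1` [set 1%:M] by [].
apply: preimage_closed => //.
exact/accessible_closed_set1/hausdorff_accessible/norm_hausdorff.
Qed.

Lemma ler_norm_orthogonal (A : 'M[R]_n) : orthogonal_group A -> `|A| <= 1.
Proof.
move=> oA; rewrite [leLHS]/Num.norm /= mx_normrE; apply/bigmax_leP; split=> //.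
move=> [i j] _ /=; have /matrixP/(_ i i) := oA; rewrite !mxE eqxx mulr1n => h.
rewrite -(@ler_pXn2r _ 2) ?nnegrE// expr1n real_normK ?num_real// -h (bigD1 j)//=.
by rewrite mxE expr2 lerDl; apply: sumr_ge0 => k _; rewrite mxE -expr2 sqr_ge0.
Qed.

Lemma compact_orthogonal : compact (@orthogonal_group R n).
Proof.
exact: bounded_closed_mx_compact ler_norm_orthogonal closed_orthogonal.
Qed.

Lemma dot_continuousr (x : 'cV[R]_n) : continuous (dot x).
Proof.
apply: sum_continuous => k; apply: mulr_continuous; first exact: cst_continuous.
exact: coord_continuous.
Qed.

Lemma enorm_continuous : continuous (@enorm R n).
Proof.
move=> x; apply: (@continuous_comp _ _ _ (fun x => dot x x) Num.sqrt); last first.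
  exact: sqrt_continuous.
move: x; apply: sum_continuous => k; apply: mulr_continuous; exact: coord_continuous.
Qed.

Lemma enormB_continuous (y : 'cV[R]_n) : continuous (fun z : 'cV[R]_n => enorm (z - y)).
Proof.
have c : continuous (fun z : 'cV[R]_n => z - y).
  by apply: (@addmx_continuous _ _ _ id (fun=> - y)) => z A //=; exact: cst_continuous.
by move=> z; exact: (continuous_comp (c z) (enorm_continuous (x := _))).
Qed.

Lemma enorm_lip_continuous (f : 'cV[R]_n -> R) N : 0 <= N ->
  (forall y z, `|f y - f z| <= N * enorm (y - z)) -> continuous f.
Proof.
move=> N0 lf y; apply/(@cvgrPdist_le _ _ _ (nbhs y) _ f) => e e0.
have : nbhs y [set z | enorm (y - z) < e / (N + 1)].
  apply: open_nbhs_nbhs; split; last first.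
    by rewrite /= subrr enorm0 divr_gt0//; lra.
  have c : continuous (fun z : 'cV[R]_n => enorm (y - z)).
    have -> : (fun z : 'cV[R]_n => enorm (y - z)) = (fun z => enorm (z - y)).
      by apply/funext => z; rewrite -(opprB z y) enormN.
    exact: enormB_continuous.
  have -> : [set z | enorm (y - z) < e / (N + 1)] =
      (fun z : 'cV[R]_n => enorm (y - z)) @^-1` [set r | r < e / (N + 1)] by [].
  by apply: open_comp => [z _|]; [exact: c|exact: open_lt].
apply: filterS => z /=; rewrite ltr_pdivlMr; last by lra.
move=> ze; apply: (le_trans (lf y z)).
by have := enorm_ge0 (y - z); lra.
Qed.

Lemma compact_eball (r : R) : compact [set x : 'cV[R]_n | enorm x <= r].
Proof.
apply: (bounded_closed_mx_compact (M := `|r|)).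
  move=> B Br; rewrite [leLHS]/Num.norm /= mx_normrE; apply/bigmax_leP; split=> //.
  move=> [i j] _ /=; rewrite ord1; apply: (le_trans (ler_coord_enorm _ _)).
  exact: le_trans (ler_norm _).
exact: (preimage_closed (fun x _ => enorm_continuous (x := x)) (@closed_le _ r)).
Qed.

Lemma ler_enorm_mulmx (M : 'M[R]_n) (x : 'cV[R]_n) :
  enorm (M *m x) <= n%:R ^+ 2 * enorm x * `|M|.
Proof.
apply: (le_trans (enorm_le_sum _)).
have -> : n%:R ^+ 2 * enorm x * `|M| = \sum_(i < n) \sum_(k < n) `|M| * enorm x.
  by rewrite !sumr_const !card_ord -mulrnA -[in RHS]mulr_natr natrM; ring.
apply: ler_sum => i _; rewrite mxE; apply: (le_trans (ler_norm_sum _ _ _)).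
apply: ler_sum => k _; rewrite normrM.
by apply: ler_pM => //; [exact: ler_coord_norm|exact: ler_coord_enorm].
Qed.

Lemma ler_norm_trmx {p q} (M : 'M[R]_(p, q)) : `|M^T| <= `|M|.
Proof.
rewrite [leLHS]/Num.norm /= mx_normrE; apply/bigmax_leP; split=> // -[i j] _ /=.
by rewrite mxE; exact: ler_coord_norm.
Qed.

Lemma ler_norm_enorm (x : 'cV[R]_n) : `|x| <= enorm x.
Proof.
rewrite [leLHS]/Num.norm /= mx_normrE; apply/bigmax_leP; split=> //.
  exact: enorm_ge0.
by move=> [i j] _ /=; rewrite ord1; exact: ler_coord_enorm.
Qed.

End MatrixTopology.

(** * Averages along words of reflections *)

Section Averaging.
Context {R : realType} {p : nat}.
Implicit Types r : nat -> 'M[R]_p.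

(* The action of [k] successive symmetrals on conjugates. *)
Fixpoint lavg {q} r (H : 'M[R]_(p, q) -> R) k (A : 'M[R]_(p, q)) : R :=
  if k is k'.+1 then 2^-1 * (lavg r H k' A + lavg r H k' (r k' *m A)) else H A.

(* Each word enters the average [lavg r _ k] with weight at least [2^-k]. *)
Fixpoint words r k : set 'M[R]_p :=
  if k is k'.+1 then words r k' `|` [set w *m r k' | w in words r k']
  else [set 1%:M].

Lemma lavg_shift {q} r (H : 'M[R]_(p, q) -> R) j k A :
  lavg r H (j + k) A = lavg (fun i => r (j + i)%N) (lavg r H j) k A.
Proof. by elim: k A => [|k IH] A; rewrite ?addn0// addnS /= !IH. Qed.

(** Links averages over the group to averages at a point: for a column [Y = y], the averages of
    [A |-> f (A *m y)] are those of [f] along the orbit of [y]. *)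
Lemma lavg_comp {q} r (H : 'M[R]_(p, q) -> R) (Y : 'M[R]_(p, q)) k A :
  lavg r (fun B => H (B *m Y)) k A = lavg r H k (A *m Y).
Proof. by elim: k A => [|k IH] A //=; rewrite !IH mulmxA. Qed.

Lemma lavg_mono {q} r (D : set 'M[R]_(p, q)) (H G : 'M[R]_(p, q) -> R) k :
  (forall i A, D A -> D (r i *m A)) -> (forall A, D A -> H A <= G A) ->
  forall A, D A -> lavg r H k A <= lavg r G k A.
Proof.
move=> rD HG; elim: k => [|k IH] A DA /=; first exact: HG.
by rewrite ler_pM2l ?invr_gt0// lerD// IH//; exact: rD.
Qed.

Lemma lavg_cst {q} r (c : R) k (A : 'M[R]_(p, q)) : lavg r (fun=> c) k A = c.
Proof. by elim: k A => [|k IH] A //=; rewrite !IH; field. Qed.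

Lemma lavg_le_cst {q} r (D : set 'M[R]_(p, q)) (H : 'M[R]_(p, q) -> R) c k :
  (forall i A, D A -> D (r i *m A)) -> (forall A, D A -> H A <= c) ->
  forall A, D A -> lavg r H k A <= c.
Proof. by move=> rD Hc A /(lavg_mono k rD Hc); rewrite lavg_cst. Qed.

Lemma lavg_ge_cst {q} r (D : set 'M[R]_(p, q)) (H : 'M[R]_(p, q) -> R) c k :
  (forall i A, D A -> D (r i *m A)) -> (forall A, D A -> c <= H A) ->
  forall A, D A -> c <= lavg r H k A.
Proof. by move=> rD Hc A /(lavg_mono k rD Hc); rewrite lavg_cst. Qed.

Lemma lavg_word_le {q} r (D : set 'M[R]_(p, q)) (H : 'M[R]_(p, q) -> R) b k w :
  (forall i A, D A -> D (r i *m A)) -> (forall A, D A -> H A <= b) ->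
  words r k w -> forall A, D A ->
  lavg r H k A <= (1 - 2^-1 ^+ k) * b + 2^-1 ^+ k * H (w *m A).
Proof.
move=> rD Hb; elim: k w => [|k IH] w /=.
  by move=> -> A DA; rewrite mul1mx expr0 subrr mul0r add0r mul1r.
move=> kw A DA; rewrite exprS; set t := _ ^+ k.
suff : lavg r H k A + lavg r H k (r k *m A) <=
    b + ((1 - t) * b + t * H (w *m A)) by nra.
have lb B : D B -> lavg r H k B <= b by apply: lavg_le_cst.
case: kw => [kw|[v kv <-]]; first by rewrite addrC lerD ?IH ?lb//; exact: rD.
by rewrite lerD ?lb// -mulmxA IH//; exact: rD.
Qed.

Lemma lavgN {q} r (H : 'M[R]_(p, q) -> R) k A :
  lavg r (fun B => - H B) k A = - lavg r H k A.
Proof. by elim: k A => [|k IH] A //=; rewrite !IH -opprD mulrN. Qed.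

Lemma lavg_word_ge {q} r (D : set 'M[R]_(p, q)) (H : 'M[R]_(p, q) -> R) a k w :
  (forall i A, D A -> D (r i *m A)) -> (forall A, D A -> a <= H A) ->
  words r k w -> forall A, D A ->
  (1 - 2^-1 ^+ k) * a + 2^-1 ^+ k * H (w *m A) <= lavg r H k A.
Proof.
move=> rD Ha kw A DA.
have Na B : D B -> - H B <= - a by move=> DB; rewrite lerN2 Ha.
by have := lavg_word_le rD Na kw DA; rewrite lavgN !mulrN -opprD lerN2.
Qed.

Lemma words_mono r k l : (k <= l)%N -> words r k `<=` words r l.
Proof.
move=> /subnK <-; elim: (l - k)%N => // j IH w /IH; rewrite addSn /=.
by left.
Qed.

Section Orthogonal.
Variable r : nat -> 'M[R]_p.
Hypothesis orthr : forall i, orthogonal_group (r i).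

Lemma words_orthogonal k : words r k `<=` orthogonal_group.
Proof.
elim: k => [|k IH] w /=; first by move=> ->; exact: orthogonal1.
by case=> [/IH//|[v /IH ov <-]]; exact: orthogonalM.
Qed.

Variable m : nat.
Hypothesis m_gt0 : (0 < m)%N.
Hypothesis perr : forall i, r (m + i)%N = r i.

Let perr_mul k i : r (m * k + i)%N = r i.
Proof. by elim: k => [|k IH]; rewrite ?muln0// mulnS -addnA perr IH. Qed.

Section Generation.
Hypothesis symr : forall i, (r i)^T = r i.
Hypothesis genr : closed_subgroup_generated (range r) = orthogonal_group.

Let W := \bigcup_k words r k.

Let W_step w i : W w -> W (w *m r i).
Proof.
(* A reflection can be appended only at its own time. Skipping steps until time [m * k + i], which
   is at least [k], makes [r i] available by periodicity. *)
move=> [k _ kw]; exists (m * k + i).+1 => //=; right; exists w.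
  by apply: words_mono kw; rewrite (leq_trans _ (leq_addr _ _))// leq_pmull.
by rewrite perr_mul.
Qed.

Let W1 : W 1%:M. Proof. by exists 0%N. Qed.

Let W_mul v w : W v -> W w -> W (v *m w).
Proof.
move=> Wv [k _]; elim: k w => [|k IH] w /=; first by move=> ->; rewrite mulmx1.
by case=> [/IH//|[w' /IH + <-]]; rewrite mulmxA; exact: W_step.
Qed.

Let W_tr w : W w -> W w^T.
Proof.
move=> [k _]; elim: k w => [|k IH] w /=; first by move=> ->; rewrite trmx1.
case=> [/IH//|[w' /IH Ww' <-]]; rewrite trmx_mul symr; apply: W_mul => //.
by rewrite -[r k]mul1mx; exact: W_step.
Qed.

Let closureW_map (f : 'M[R]_p -> 'M[R]_p) : continuous f ->
  (forall w, W w -> closure W (f w)) -> forall A, closure W A -> closure W (f A).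
Proof.
move=> fc fW A cA.
have cl : closed (f @^-1` closure W).
  by apply: preimage_closed => [x _|]; [exact: fc|exact: closed_closure].
by move: cA => /(closure_subset (B := f @^-1` closure W) fW); rewrite -(closure_id _).1.
Qed.

(** The closure of the set of words is itself a closed subgroup containing every [r i]. Products
    pass to the closure one factor at a time; inverses are transposes, which reverse words in
    symmetric letters. *)
Lemma orthogonal_closure_words : orthogonal_group `<=` closure W.
Proof.
rewrite -genr; apply: smallest_sub; last first.
  move=> _ [i _ <-]; apply: subset_closure; rewrite -[r i]mul1mx; exact: W_step.
have sO : closure W `<=` orthogonal_group.
  rewrite [X in _ `<=` X](closure_id _).1; last exact: closed_orthogonal.
  by apply: closure_subset => w [k _]; exact: words_orthogonal.
split=> //; first exact: subset_closure.
- move=> A B cA cB; apply: (closureW_map (f := mulmx^~ B)) cA.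
    exact: mulmx_continuousr.
  move=> w Ww; apply: (closureW_map (f := mulmx w)) cB.
    exact: mulmx_continuousl.
  by move=> v Wv; apply: subset_closure; exact: W_mul.
- move=> A cA; rewrite invmx_orthogonal; last exact: sO.
  apply: closureW_map cA; first exact: trmx_continuous.
  by move=> w Ww; apply: subset_closure; exact: W_tr.
- exact: closed_closure.
Qed.

(** The sets [words r k] grow with [k], so a word near one [A] stays available later and serves all
    matrices near [A]; compactness of O(n) then gives one [K]. *)
Lemma words_dense (d : R) : 0 < d -> exists K, forall k, (K <= k)%N ->
  forall A, orthogonal_group A -> exists2 w, words r k w & `|w - A| < d.
Proof.
move=> d0.
have /compact_near_coveringP/(_ nat \oo (fun k A =>
  exists2 w, words r k w & `|w - A| < d)) := @compact_orthogonal R p.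
case.
  move=> A /orthogonal_closure_words cA.
  have /cA[w [[k _ kw] wA]] : nbhs A (ball A (d / 2)).
    by apply: nbhsx_ballx; rewrite divr_gt0.
  exists (ball A (d / 2), [set l | (k <= l)%N]).
    by split=> /=; [apply: nbhsx_ballx; rewrite divr_gt0|exists k].
  move=> [B l] [/= AB kl]; exists w; first exact: words_mono kw.
  move: wA AB; rewrite -!ball_normE /= => wA AB.
  rewrite -(subrK A w) -addrA (le_lt_trans (ler_normD _ _))// [d]splitr ltrD//.
  by rewrite distrC.
by move=> K _ KP; exists K => k /KP.
Qed.

(* One sweep over [K] steps moves a fixed proportion [2^-K] of the mass of every
   average close to the value of [H] at the identity. *)
Lemma lavg_narrow (H : 'M[R]_p -> R) (L : R) : 0 <= L ->
  (forall A B C D, orthogonal_group A -> orthogonal_group B ->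
     orthogonal_group C -> orthogonal_group D ->
     `|H (C *m A *m D) - H (C *m B *m D)| <= L * `|A - B|) ->
  forall e, 0 < e -> exists j a b, b - a <= e /\
    forall k A, (j <= k)%N -> orthogonal_group A -> a <= lavg r H k A <= b.
Proof.
move=> L0 lipH e e0.
have rO i A : orthogonal_group A -> orthogonal_group (r i *m A).
  exact: orthogonalM.
(* [C] takes up the reflections that each averaging step inserts on the left; [D] will be [A] itself
   when [w] is compared with [A^T]. *)
have lip k A B C D : orthogonal_group A -> orthogonal_group B ->
     orthogonal_group C -> orthogonal_group D ->
     `|lavg r H k (C *m A *m D) - lavg r H k (C *m B *m D)| <= L * `|A - B|.
  elim: k A B C D => [|k IH] A B C D oA oB oC oD /=; first exact: lipH.
  rewrite -mulrBr opprD addrACA normrM ger0_norm ?invr_ge0//.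
  have h1 := IH _ _ _ _ oA oB oC oD.
  have h2 := IH _ _ _ _ oA oB (rO k _ oC) oD.
  rewrite !mulmxA.
  by have := ler_normD (lavg r H k (C *m A *m D) - lavg r H k (C *m B *m D))
    (lavg r H k (r k *m C *m A *m D) - lavg r H k (r k *m C *m B *m D)); lra.
pose d := e / (4 * (L + 1)).
have L1 : 0 < 4 * (L + 1) by lra.
have d0 : 0 < d by rewrite divr_gt0.
have Ld : L * d <= e / 4.
  have -> : e / 4 = (L + 1) * d by rewrite /d; field; lra.
  by rewrite ler_wpM2r ?lerDl// ltW.
have [K0 K0P] := words_dense d0.
(* A multiple of the period, so that each sweep starts with the same reflections. *)
pose K := (m * K0)%N; have {K0P} KP := K0P K (leq_pmull _ m_gt0).
pose t : R := 2^-1 ^+ K.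
have t0 : 0 < t by rewrite exprn_gt0// invr_gt0.
have t1 : t <= 1 by rewrite exprn_ile1// ?invr_ge0// invf_le1// ler1n.
have step i a b : (forall A, orthogonal_group A -> a <= lavg r H (K * i) A <= b) ->
    exists a' b', b' - a' <= (1 - t) * (b - a) + t * (e / 2) /\
    forall A, orthogonal_group A -> a' <= lavg r H (K * i.+1) A <= b'.
  move=> ab; pose h := lavg r H (K * i) 1%:M.
  exists ((1 - t) * a + t * (h - e / 4)), ((1 - t) * b + t * (h + e / 4)).
  split; first by lra.
  move=> A oA; have oA' := orthogonal_tr oA.
  (* Since [w] is close to [A^T], the point [w *m A] is close to the identity: the same value [h]
     attracts the average at every [A]. *)
  have [w Kw wA] := KP _ oA'; have ow := words_orthogonal Kw.
  have hw : `|lavg r H (K * i) (w *m A) - h| <= e / 4.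
    have := lip (K * i)%N w A^T 1%:M A ow oA' orthogonal1 oA.
    rewrite !mul1mx (mulmx1C oA) => /le_trans; apply; apply: le_trans Ld.
    by rewrite ler_wpM2l// ltW.
  have shift : lavg r H (K * i.+1) A = lavg r (lavg r H (K * i)) K A.
    rewrite mulnS addnC lavg_shift; congr (lavg _ _ _ _).
    by apply/funext => l; rewrite -mulnA perr_mul.
  have aw B : orthogonal_group B -> a <= lavg r H (K * i) B by move=> /ab/andP[].
  have wb B : orthogonal_group B -> lavg r H (K * i) B <= b by move=> /ab/andP[].
  move: hw; rewrite ler_norml shift => /andP[hw1 hw2]; apply/andP; split.
    apply: le_trans (lavg_word_ge rO aw Kw oA); rewrite -/t.
    by rewrite lerD2l ler_wpM2l ?(ltW t0)//; lra.
  apply: (le_trans (lavg_word_le rO wb Kw oA)); rewrite -/t.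
  by rewrite lerD2l ler_wpM2l ?(ltW t0)//; lra.
(* The recursion [x |-> (1 - t) x + t e / 2] has fixed point [e / 2]; the initial width [4 L] comes
   from [|A - 1| <= 2] on O(n). *)
have iter i : exists a b, b - a <= (1 - t) ^+ i * (4 * L) + e / 2 /\
    forall A, orthogonal_group A -> a <= lavg r H (K * i) A <= b.
  elim: i => [|i [a [b [ab /step[a' [b' [ab' hab']]]]]]].
    exists (H 1%:M - 2 * L), (H 1%:M + 2 * L); split; first by rewrite expr0; lra.
    rewrite muln0 => A oA /=.
    have := lipH A 1%:M 1%:M 1%:M oA orthogonal1 orthogonal1 orthogonal1.
    rewrite !mul1mx !mulmx1 => hA.
    have : L * `|A - 1%:M| <= L * 2.
      rewrite ler_wpM2l// (le_trans (ler_normB _ _))// (_ : 2 = 1 + 1)//.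
      by apply: lerD; apply: ler_norm_orthogonal => //; exact: orthogonal1.
    by move: hA; rewrite ler_norml => /andP[]; lra.
  exists a', b'; split=> //; apply: (le_trans ab'); rewrite exprS.
  have : (1 - t) * (b - a) <= (1 - t) * ((1 - t) ^+ i * (4 * L) + e / 2).
    by rewrite ler_wpM2l// subr_ge0.
  by nra.
have [i iP] : exists i, (1 - t) ^+ i * (4 * L) <= e / 2.
  have : (fun i => (1 - t) ^+ i * (4 * L)) @ \oo --> (0 : R).
    rewrite -(mul0r (4 * L)); apply: cvgM; last exact: cvg_cst.
    by apply: cvg_expr; rewrite ger0_norm ?subr_ge0//; lra.
  move=> /cvgrPdist_le/(_ (e / 2)); rewrite divr_gt0// => /(_ isT) [i _ /(_ i)].
  rewrite /= leqnn sub0r normrN => /(_ isT) hi; exists i.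
  exact: le_trans (ler_norm _) hi.
have [a [b [ab hab]]] := iter i.
exists (K * i)%N, a, b; split; first by lra.
(* Later averages are means of values at time [K * i] over O(n), so they stay in the same interval
   between sweeps too. *)
move=> k A /subnKC <- oA; rewrite lavg_shift.
have rO' l B : orthogonal_group B -> orthogonal_group (r (K * i + l) *m B).
  exact: orthogonalM.
apply/andP; split.
  by apply: lavg_ge_cst rO' _ _ oA => B /hab/andP[].
by apply: lavg_le_cst rO' _ _ oA => B /hab/andP[].
Qed.

(** The limit is the supremum of all eventual lower bounds, which lies in each of the arbitrarily
    short intervals of [lavg_narrow]. These hold for all [A] at once, so neither [c] nor the rate
    depends on [A]. *)
Lemma lavg_cvg (H : 'M[R]_p -> R) (L : R) : 0 <= L ->
  (forall A B C D, orthogonal_group A -> orthogonal_group B ->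
     orthogonal_group C -> orthogonal_group D ->
     `|H (C *m A *m D) - H (C *m B *m D)| <= L * `|A - B|) ->
  exists c, forall e, 0 < e -> exists K, forall k A, (K <= k)%N ->
    orthogonal_group A -> `|lavg r H k A - c| <= e.
Proof.
move=> L0 lipH.
pose S := [set a | exists j, forall k A, (j <= k)%N -> orthogonal_group A ->
  a <= lavg r H k A].
have Sle j a b : (forall k A, (j <= k)%N -> orthogonal_group A ->
    a <= lavg r H k A <= b) -> S a /\ ubound S b.
  move=> ab; split; first by exists j => k A jk oA; case/andP: (ab k A jk oA).
  move=> a' [j' a'P].
  apply: (le_trans (a'P (maxn j j') _ (leq_maxr _ _) orthogonal1)).
  by case/andP: (ab (maxn j j') _ (leq_maxl _ _) orthogonal1).
exists (sup S) => e e0.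
have [j [a [b [ab jP]]]] := lavg_narrow L0 lipH e0.
have [Sa Sb] := Sle _ _ _ jP.
have aS : a <= sup S by apply: ub_le_sup => //; exists b.
have Sb' : sup S <= b by apply: ge_sup => //; exists a.
by exists j => k A jk oA; move: (jP k A jk oA) => /andP[]; rewrite ler_norml; lra.
Qed.

End Generation.
End Orthogonal.
End Averaging.

(** * Identification of the limit with the Haar mean *)

Section RightAveraging.
Context {R : realType} {p : nat}.
Implicit Types r : nat -> 'M[R]_p.

Lemma lavgD {q} r (H G : 'M[R]_(p, q) -> R) k A :
  lavg r (fun B => H B + G B) k A = lavg r H k A + lavg r G k A.
Proof. by elim: k A => [|k IH] A //=; rewrite !IH; ring. Qed.

Lemma lavgZ {q} r (H : 'M[R]_(p, q) -> R) c k A :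
  lavg r (fun B => c * H B) k A = c * lavg r H k A.
Proof. by elim: k A => [|k IH] A //=; rewrite !IH; ring. Qed.

(** Averaging after transposition multiplies by reflections on the right, since these are symmetric;
    left and right multiplications commute by associativity. *)
Lemma lavg_trC r (H : 'M[R]_p -> R) j k A : (forall i, (r i)^T = r i) ->
  lavg r (fun B => lavg r (fun C => H C^T) k B^T) j A =
  lavg r (fun B => lavg r H j B^T) k A^T.
Proof.
move=> symr; elim: j A => [|j IH] A //=; rewrite !IH lavgZ lavgD; congr (_ * (_ + _)).
rewrite trmx_mul symr -lavg_comp.
by congr (lavg _ _ _ _); apply/funext => B; rewrite trmx_mul symr.
Qed.

End RightAveraging.

(** * Integration against the Haar measure *)

Section Haar.
Context {R : realType} {p : nat} (eta : probability (borel_matrix R p) R).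
Hypothesis haar : haar_probability eta.
Local Notation O := (@orthogonal_group R p).

Lemma closed_measurable_borel (A : set 'M[R]_p) :
  closed A -> measurable (A : set (borel_matrix R p)).
Proof.
move=> cA; rewrite -(setCK A); apply: measurableC.
by apply: sub_sigma_algebra; exact: closed_openC.
Qed.

Lemma measurable_orthogonal : measurable (O : set (borel_matrix R p)).
Proof. by apply: closed_measurable_borel; exact: closed_orthogonal. Qed.

Lemma lsc_measurable_borel (f : borel_matrix R p -> \bar R) :
  lower_semicontinuous (f : 'M[R]_p -> \bar R) ->
  measurable_fun setT f.
Proof.
move=> lf; apply: (measurability _ (ErealGenOInfty.measurableE R)).
move=> _ [_ [a ->]] <-; apply: measurableI => //.
apply: sub_sigma_algebra; rewrite preimage_itvoy.
by move/lower_semicontinuousP : lf; exact.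
Qed.

Lemma continuous_lsc {T : topologicalType} (f : T -> R) :
  continuous f -> lower_semicontinuous (EFin \o f).
Proof.
move=> fc; apply/lower_semicontinuousP => a.
rewrite (_ : mkset _ = f @^-1` [set x | a < x]).
  by apply: open_comp => [x _|]; [exact: fc|exact: open_gt].
by apply/seteqP; split=> x /=; rewrite lte_fin.
Qed.

Lemma integrable_borel (f : 'M[R]_p -> R) : continuous f ->
  eta.-integrable O (EFin \o (f : borel_matrix R p -> R)).
Proof.
move=> fc; apply: measurable_bounded_integrable.
- exact: measurable_orthogonal.
- by apply: le_lt_trans (ltry 1); rewrite -haar.1.
- apply/measurable_EFinP; apply: measurable_funTS.
  by apply: lsc_measurable_borel; exact: continuous_lsc.
- have := compact_bounded (continuous_compact (continuous_subspaceT fc)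
    (@compact_orthogonal R p)).
  move=> [M [Mr MP]]; exists M; split=> // N /MP h A OA /=.
  by apply: h; exists A.
Qed.

Lemma integral_mull (f : 'M[R]_p -> R) (t : 'M[R]_p) : continuous f -> O t ->
  (\int[eta]_(A in O) (f (t *m A))%:E = \int[eta]_(A in O) (f A)%:E)%E.
Proof.
move=> fc Ot; have Ot' := orthogonal_tr Ot.
pose phi : borel_matrix R p -> borel_matrix R p := mulmx t.
have preE (S : set 'M[R]_p) : phi @^-1` S = [set t^T *m A | A in S].
  apply/seteqP; split=> A /=.
    by move=> SA; exists (t *m A) => //; rewrite mulmxA (mulmx1C Ot) mul1mx.
  by move=> [B SB <-]; rewrite /phi mulmxA Ot mul1mx.
have mphi : measurable_fun setT phi.
  apply: (@measurability _ _ (borel_matrix R p) (borel_matrix R p) setT phi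
    (@open 'M[R]_p) erefl) => _ [S oS <-]; rewrite setTI.
  apply: sub_sigma_algebra; apply: open_comp oS => A _.
  exact: mulmx_continuousl.
have preO : phi @^-1` O = O.
  apply/seteqP; split=> A /=; last exact: orthogonalM.
  by move/(orthogonalM Ot'); rewrite /phi mulmxA (mulmx1C Ot) mul1mx.
have ftc : continuous (f \o phi).
  by move=> A; apply: continuous_comp; [exact: mulmx_continuousl|exact: fc].
rewrite -[in LHS]preO -(@integral_pushforward _ _ _ _ _ phi mphi eta O (EFin \o f)).
- apply: eq_measure_integral => S mS _.
  by rewrite /= /pushforward preE haar.2.
- by apply: lsc_measurable_borel; exact: continuous_lsc.
- by rewrite preO; exact: (integrable_borel ftc).
- exact: measurable_orthogonal.
Qed.

Lemma lavg_continuous {q} r (f : 'M[R]_(p, q) -> R) k :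
  continuous f -> continuous (lavg r f k).
Proof.
move=> fc; elim: k => [|k IH]; first exact: fc.
have h : continuous (fun A : 'M[R]_(p, q) => lavg r f k (r k *m A)).
  move=> x; apply: (@continuous_comp _ _ _ (mulmx (r k))); last exact: IH.
  exact: mulmx_continuousl.
apply: (@mulr_continuous _ _ (fun=> 2^-1)) => x; first exact: cst_continuous.
exact: cvgD (IH x) (h x).
Qed.

Lemma integral_lavg r (f : 'M[R]_p -> R) k : (forall i, O (r i)) ->
  continuous f ->
  (\int[eta]_(A in O) (lavg r f k A)%:E = \int[eta]_(A in O) (f A)%:E)%E.
Proof.
move=> Or fc; elim: k => [|k IH] //=.
have kc := lavg_continuous (r := r) (k := k) fc.
have rkc : continuous (fun A : 'M[R]_p => lavg r f k (r k *m A)).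
  move=> x; apply: (@continuous_comp _ _ _ (mulmx (r k))); last exact: kc.
  exact: mulmx_continuousl.
under eq_integral do rewrite EFinM EFinD.
rewrite integralZl//; [|exact: measurable_orthogonal|]; last first.
  by apply: integrableD; [exact: measurable_orthogonal|exact: integrable_borel..].
rewrite integralD//; [|exact: measurable_orthogonal|exact: integrable_borel..].
rewrite integral_mull// IH.
have /integrable_fin_num fin := integrable_borel fc.
rewrite -(fineK (fin _)); last exact: measurable_orthogonal.
by rewrite -EFinD -EFinM; congr EFin; field.
Qed.

Lemma integral_close (f : 'M[R]_p -> R) c e : continuous f ->
  (forall A, O A -> `|f A - c| <= e) ->
  `|fine (\int[eta]_(A in O) (f A)%:E)%E - c| <= e.
Proof.
move=> fc fe.
have mO := measurable_orthogonal.
have fin := integrable_fin_num mO (integrable_borel fc).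
have cstE a : (\int[eta]_(A in O) a%:E = a%:E)%E.
  by rewrite (integral_cst _ mO) -[RHS]mule1 -haar.1.
have icst a : eta.-integrable O (EFin \o cst a).
  exact: finite_measure_integrable_cst.
rewrite ler_norml; apply/andP; split; rewrite -lee_fin EFinB fineK//.
  rewrite leeBrDr// -EFinD -[leLHS]cstE;
    apply: (le_integral mO (icst _) (integrable_borel fc)).
  by move=> A /set_mem/fe; rewrite lee_fin ler_norml lerBrDr => /andP[].
rewrite leeBlDr// -EFinD -[leRHS]cstE;
  apply: (le_integral mO (integrable_borel fc) (icst _)).
by move=> A /set_mem/fe; rewrite lee_fin ler_norml lerBlDr => /andP[].
Qed.

Section Mean.
Variables (r : nat -> 'M[R]_p) (m : nat).
Hypothesis Or : forall i, O (r i).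
Hypothesis m_gt0 : (0 < m)%N.
Hypothesis perr : forall i, r (m + i)%N = r i.
Hypothesis symr : forall i, (r i)^T = r i.
Hypothesis genr : closed_subgroup_generated (range r) = O.

(* The limits of the left and of the right averages agree because the two kinds
   of averaging commute; left invariance of [eta] controls the former for
   [H \o trmx], hence no unimodularity is needed. *)
Lemma lavg_cvg_haar (H : 'M[R]_p -> R) (L : R) : 0 <= L ->
  continuous H ->
  (forall A B C D, O A -> O B -> O C -> O D ->
     `|H (C *m A *m D) - H (C *m B *m D)| <= L * `|A - B|) ->
  forall e, 0 < e -> exists K, forall k A, (K <= k)%N -> O A ->
    `|lavg r H k A - fine (\int[eta]_(B in O) (H B^T)%:E)%E| <= e.
Proof.
move=> L0 Hc lipH.
pose H' (B : 'M[R]_p) := H B^T.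
have H'c : continuous H'.
  move=> B; apply: (@continuous_comp _ _ _ trmx); last exact: Hc.
  exact: trmx_continuous.
have lipH' A B C D : O A -> O B -> O C -> O D ->
     `|H' (C *m A *m D) - H' (C *m B *m D)| <= L * `|A - B|.
  move=> OA OB OC OD; rewrite /H' !trmx_mul !mulmxA.
  apply: (le_trans (lipH _ _ _ _ _ _ _ _)); do ?exact: orthogonal_tr.
  by rewrite -linearB /= ler_wpM2l// ler_norm_trmx.
have [c cP] := lavg_cvg Or m_gt0 perr symr genr L0 lipH.
have [c' c'P] := lavg_cvg Or m_gt0 perr symr genr L0 lipH'.
have OrA i A : O A -> O (r i *m A) by exact: orthogonalM.
have c'E : fine (\int[eta]_(B in O) (H B^T)%:E)%E = c'.
  apply/eqP; rewrite -subr_eq0 -normr_le0; apply/ler_addgt0Pl => e e0.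
  rewrite addr0; have [K KP] := c'P e e0.
  rewrite -(integral_lavg K Or H'c); apply: integral_close.
    exact: lavg_continuous.
  by move=> A OA; exact: KP.
(* One double average, [K] steps on one side and [K'] on the other, is within [e / 2] of both [c]
   and [c']. *)
have cc' : c = c'.
  apply/eqP; rewrite -subr_eq0 -normr_le0; apply/ler_addgt0Pl => e e0.
  rewrite addr0; have e20 : 0 < e / 2 by rewrite divr_gt0.
  have [K KP] := cP _ e20; have [K' K'P] := c'P _ e20.
  have bnd (G : 'M[R]_p -> R) x k B : O B -> (forall A, O A -> `|G A - x| <= e / 2) ->
      `|lavg r G k B - x| <= e / 2.
    move=> OB Gx; rewrite ler_norml lerBrDr lerBlDr; apply/andP; split.
      apply: lavg_ge_cst OrA _ _ OB => A /Gx.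
      by rewrite ler_norml lerBrDr => /andP[].
    apply: lavg_le_cst OrA _ _ OB => A /Gx.
    by rewrite ler_norml lerBlDr => /andP[].
  have O1 := @orthogonal1 R p; have O1t := orthogonal_tr O1.
  have := bnd _ c' K _ O1 (fun A OA => K'P K' A^T (leqnn _) (orthogonal_tr OA)).
  have := bnd _ c K' _ O1t (fun A OA => KP K A^T (leqnn _) (orthogonal_tr OA)).
  rewrite lavg_trC//; set X := lavg _ _ _ _.
  by rewrite !ler_norml => /andP[? ?] /andP[? ?]; apply/andP; split; lra.
by rewrite c'E -cc'.
Qed.

End Mean.
End Haar.

(** * Convex analysis *)

Section LowerSemicontinuity.
Context {R : realType}.
Local Open Scope ereal_scope.

Lemma EFin_lt_mid (a : R) (x : \bar R) : a%:E < x ->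
  exists2 b : R, (a < b)%R & b%:E < x.
Proof.
case: x => [x| |]//; last by exists (a + 1)%R; rewrite ?ltry ?ltrDl.
by rewrite lte_fin => ax; exists ((a + x) / 2)%R; rewrite ?lte_fin; lra.
Qed.

Lemma EFin_ltD_split (a : R) (x y : \bar R) : -oo < x -> -oo < y ->
  a%:E < x + y -> exists b c : R, [/\ (a <= b + c)%R, b%:E < x & c%:E < y].
Proof.
case: x => [x| |]// _; case: y => [y| |]// _.
- rewrite -EFinD lte_fin => axy.
  exists (x - (x + y - a) / 2)%R, (y - (x + y - a) / 2)%R.
  by rewrite !lte_fin; split; lra.
- by exists (x - 1)%R, (a - x + 1)%R; rewrite lte_fin ltry; split=> //; lra.
- by exists (a - y + 1)%R, (y - 1)%R; rewrite lte_fin ltry; split=> //; lra.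
- by exists a, 0%R; rewrite !ltry addr0.
Qed.

Context {T : topologicalType}.
Implicit Types f g : T -> \bar R.

Lemma lscD f g : (forall x, -oo < f x) -> (forall x, -oo < g x) ->
  lower_semicontinuous f -> lower_semicontinuous g ->
  lower_semicontinuous (fun x => f x + g x).
Proof.
move=> f0 g0 fl gl x a /(EFin_ltD_split (f0 x) (g0 x)) [b [c [abc bf cg]]].
have [V xV Vf] := fl _ _ bf; have [W xW Wg] := gl _ _ cg.
exists (V `&` W); first exact: filterI.
move=> y [/Vf fy /Wg gy]; apply: (@le_lt_trans _ _ (b + c)%:E).
  by rewrite lee_fin.
by rewrite EFinD lteD.
Qed.

Lemma lsc_comp {U : topologicalType} f (h : U -> T) : continuous h ->
  lower_semicontinuous f -> lower_semicontinuous (f \o h).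
Proof.
move=> hc fl x a /fl[V xV Vf]; exists (h @^-1` V); first exact: hc.
by move=> y /Vf.
Qed.

Lemma lsc_lower_bound f (K : set T) : compact K -> lower_semicontinuous f ->
  (forall x, -oo < f x) -> exists c : R, forall x, K x -> c%:E <= f x.
Proof.
move=> /compact_near_coveringP cK fl f0.
have := cK nat \oo (fun k x => (- k%:R)%:E < f x).
case=> [x Kx|k _ kP].
  have [c cf] : exists c : R, c%:E < f x.
    move: (f0 x); case: (f x) => [r| |]// _; last by exists 0%R; rewrite ltry.
    by exists (r - 1)%R; rewrite lte_fin; lra.
  have [V xV Vf] := fl _ _ cf.
  exists (V, [set k | (Num.truncn `|c|).+1 <= k]%N).
    by split=> //=; exists (Num.truncn `|c|).+1.
  move=> [y k] /= [Vy ck]; apply: le_lt_trans (Vf _ Vy); rewrite lee_fin.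
  rewrite lerNl; apply: (le_trans (ler_norm _)); rewrite normrN.
  apply: (@le_trans _ _ (Num.truncn `|c|).+1%:R); last by rewrite ler_nat.
  by rewrite ltW// truncnS_gt.
by exists (- k%:R)%R => x Kx; apply/ltW/kP => //=.
Qed.

(** If the infimum were not attained, [f] would exceed it everywhere on [K], and compactness would
    turn this into a uniform gap [1 / (k + 1)], which an infimum excludes. *)
Lemma lsc_min f (K : set T) : compact K -> K !=set0 -> lower_semicontinuous f ->
  (forall x, -oo < f x) -> exists2 z, K z & forall w, K w -> f z <= f w.
Proof.
move=> cK [x0 Kx0] fl f0.
have [c cf] := lsc_lower_bound cK fl f0.
pose m := ereal_inf (f @` K).
have mf w : K w -> m <= f w by move=> Kw; apply: ereal_inf_lbound; exists w.
have cm : c%:E <= m by apply: le_ereal_inf_tmp => _ [w Kw <-]; exact: cf.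
have [[z Kz zm]|noz] := pselect (exists2 z, K z & f z <= m).
  by exists z => // w /mf; exact: le_trans.
have mltf z : K z -> m < f z.
  by move=> Kz; rewrite ltNge; apply/negP => zm; apply: noz; exists z.
have [r mr] : exists r : R, m = r%:E.
  have := mltf _ Kx0; move: cm; case: (m) => [r| |]//; first by exists r.
  by move=> _; rewrite ltNge leey.
move/compact_near_coveringP : cK => cK.
have := cK nat \oo (fun k x => (r + k.+1%:R^-1)%:E < f x).
case=> [x Kx|k _ kP].
  have := mltf _ Kx; rewrite mr => /EFin_lt_mid [b rb bf].
  have [V xV Vf] := fl _ _ bf.
  exists (V, [set k | k.+1%:R^-1 < b - r]%R).
    split=> //=.
    have := @near_infty_natSinv_lt R (PosNum (_ : 0 < b - r)%R); apply.
    by rewrite subr_gt0.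
  move=> [y k] /= [Vy kb]; apply: lt_trans (Vf _ Vy); rewrite lte_fin.
  by rewrite addrC -ltrBrDr.
have : (r + k.+1%:R^-1)%:E <= m.
  by apply: le_ereal_inf_tmp => _ [w Kw <-]; apply/ltW/kP => //=.
by rewrite mr lee_fin gerDl leNgt invr_gt0 ltr0n.
Qed.

End LowerSemicontinuity.

Section ConvexAnalysis.
Context {R : realType} {n : nat}.
Implicit Types (psi phi : 'cV[R]_n -> \bar R) (x y z u : 'cV[R]_n).

Lemma econvex_fin psi x y (t c d : R) : econvex psi -> 0 <= t <= 1 ->
  (psi x <= c%:E)%E -> (psi y <= d%:E)%E ->
  (psi (t *: x + (1 - t) *: y)%R <= (t * c + (1 - t) * d)%:E)%E.
Proof.
move=> cpsi t01 xc yd; apply: (le_trans (cpsi x y t t01)).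
case/andP: t01 => t0 t1; rewrite (EFinD (t * c)) !EFinM leeD// lee_wpmul2l ?lee_fin//.
by rewrite subr_ge0.
Qed.

(** Testing against finite strict upper bounds keeps infinite values out of convexity proofs;
    [t = 0] and [t = 1] are separated because [0 * +oo = 0]. *)
Lemma econvex_of_lt psi : (forall x, -oo < psi x)%E ->
  (forall x y (t c d : R), 0 <= t <= 1 -> (psi x < c%:E)%E -> (psi y < d%:E)%E ->
    (psi (t *: x + (1 - t) *: y)%R <= (t * c + (1 - t) * d)%:E)%E) ->
  econvex psi.
Proof.
move=> psi0 H x y t t01; have /andP[t0 t1] := t01.
have [->|tn0] := eqVneq t 0.
  by rewrite scale0r add0r subr0 scale1r mul0e add0e mul1e.
have [->|tn1] := eqVneq t 1.
  by rewrite subrr scale0r addr0 scale1r mul0e adde0 mul1e.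
have {tn0}t0' : 0 < t by rewrite lt0r tn0.
have {tn1}t1' : 0 < 1 - t by rewrite subr_gt0 lt_neqAle tn1.
move: (psi0 x) (psi0 y) (H x y t).
case: (psi x) => [a| |]// _; last first.
  by case: (psi y) => [b| |]// _ _; rewrite !gt0_muley ?lte_fin// ?leey.
case: (psi y) => [b| |]// _ h; last by rewrite gt0_muley ?lte_fin// addey ?leey.
rewrite -!EFinM -EFinD; apply/lee_addgt0Pr => e e0.
apply: (le_trans (h (a + e) (b + e) t01 _ _)); rewrite ?lte_fin ?ltrDl//.
by rewrite -EFinD lee_fin; lra.
Qed.

(** If [x] is further than [rho] from [x0], the point of the segment at distance [rho] has value
    above [a + 1], and convexity makes [psi] rise by at least [1 / rho] per unit length on average.
    Nearer points are covered by the lower bound on a compact ball. *)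
Lemma Conv_c_growth psi : Conv_c psi -> exists s b, 0 < s /\
  forall x, ((s * enorm x - b)%:E <= psi x)%E.
Proof.
move=> [psi0 cpsi lpsi [x0 px0] copsi].
have [a x0a] : exists a, psi x0 = a%:E.
  by move: (psi0 x0) px0; case: (psi x0) => [r| |]//; exists r.
have [r rP] := copsi (a + 1).
pose rho : R := `|r| + enorm x0 + 1.
have e0 := enorm_ge0 x0.
have rho0 : 0 < rho by rewrite /rho; have := normr_ge0 r; lra.
have [c cP] := lsc_lower_bound (@compact_eball R n (rho + enorm x0)) lpsi psi0.
pose s : R := rho^-1; have s0 : 0 < s by rewrite invr_gt0.
have srho : s * rho = 1 by rewrite mulVf// gt_eqF.
have sx0 : 0 <= s * enorm x0 by rewrite mulr_ge0// ltW.
exists s, (s * (rho + enorm x0) + `|a| + `|c|); split=> // x.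
have xx0 : enorm x <= enorm (x - x0) + enorm x0.
  by rewrite -{1}(subrK x0 x) ler_enormD.
have [xrho|rhox] := leP (enorm (x - x0)) rho.
  have xK : enorm x <= rho + enorm x0 by lra.
  apply: le_trans (cP _ xK); rewrite lee_fin.
  have : s * enorm x <= s * (rho + enorm x0) by rewrite ler_wpM2l// ltW.
  by have := ler_norm (- c); rewrite normrN; have := normr_ge0 a; lra.
pose d : R := enorm (x - x0); have d0 : 0 < d by apply: lt_trans rhox.
pose t : R := rho / d.
have t0 : 0 < t by rewrite divr_gt0.
have t1 : t < 1 by rewrite ltr_pdivrMr// mul1r.
have td : t * d = rho by rewrite /t divfK// gt_eqF.
have yr : (r < enorm (t *: x + (1 - t) *: x0)).
  have : enorm (t *: (x - x0)) <= enorm (t *: x + (1 - t) *: x0) + enorm x0.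
    rewrite -(enormN x0) (_ : t *: _ = t *: x + (1 - t) *: x0 - x0) ?ler_enormD//.
    by apply/colP => i; rewrite !mxE; ring.
  rewrite enormZ ger0_norm ?(ltW t0)// -/d td.
  by rewrite /rho; have := ler_norm r; lra.
have t01 : 0 <= t <= 1 by rewrite !ltW.
have x0a' : (psi x0 <= a%:E)%E by rewrite x0a.
have := psi0 x; case xv : (psi x) => [v| |]// _; last by rewrite leey.
have xv' : (psi x <= v%:E)%E by rewrite xv.
have := lt_le_trans (rP _ yr) (econvex_fin cpsi t01 xv' x0a'); rewrite lte_fin.
move=> hv; rewrite lee_fin.
have {hv} : 1 < t * (v - a) by lra.
have -> : t = rho / d by [].
have -> : rho / d * (v - a) = (v - a) * rho / d by ring.
rewrite ltr_pdivlMr// mul1r => hv.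
have : s * d <= v - a.
  have -> : v - a = s * ((v - a) * rho) by rewrite mulrCA srho mulr1.
  by rewrite ler_wpM2l// ltW.
have : s * enorm x <= s * (d + enorm x0) by rewrite ler_wpM2l// ltW.
by have := ler_norm (- a); rewrite normrN; have := normr_ge0 c; lra.
Qed.

Lemma growth_coercive psi s b : 0 < s ->
  (forall x, ((s * enorm x - b)%:E <= psi x)%E) -> coercive psi.
Proof.
move=> s0 sP M; exists ((M + b) / s) => x.
rewrite ltr_pdivrMr// => Mx; apply: lt_le_trans (sP x).
by rewrite lte_fin; lra.
Qed.

(** The last clause is the first-order condition at the minimizer [z]: moving from [z] towards [w]
    by a fraction [t] changes the quadratic term by a linear part plus [O(t^2)], and dividing by [t]
    leaves an affine minorant touching [psi] at [z]. The middle clause locates [z]. *)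
Lemma prox psi x x0 (a b l : R) : econvex psi -> lower_semicontinuous psi ->
  (forall y, (- b)%:E <= psi y)%E -> psi x0 = a%:E -> 0 < l ->
  exists z c, [/\ psi z = c%:E,
    c + l * dot (z - x) (z - x) <= a + l * dot (x0 - x) (x0 - x) &
    forall w, ((c + 2 * l * dot (x - z) (w - z))%:E <= psi w)%E].
Proof.
move=> cpsi lpsi psib x0a l0.
have psi0 y : (-oo < psi y)%E by apply: lt_le_trans (psib y); rewrite ltNyr.
pose q (w : 'cV[R]_n) : R := l * dot (w - x) (w - x).
have qc : continuous q.
  apply: (@mulr_continuous _ _ (fun=> l)); first exact: cst_continuous.
  have -> : (fun w => dot (w - x) (w - x)) =
      (fun w : 'cV[R]_n => enorm (w - x) * enorm (w - x)).
    by apply/funext => w; rewrite -expr2 sqr_enorm.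
  by apply: mulr_continuous; exact: enormB_continuous.
pose g w := (psi w + (q w)%:E)%E.
have gl : lower_semicontinuous g.
  by apply: lscD => // [w|]; [rewrite ltNyr|exact: (continuous_lsc qc)].
have g0 w : (-oo < g w)%E.
  by rewrite /g; case: (psi w) (psi0 w) => // v _; rewrite -EFinD ltNyr.
have q0 w : 0 <= q w by rewrite mulr_ge0 ?dot_ge0// ltW.
(* Outside the ball, [l |w - x|^2 >= l M > a + q x0 + b], so no point there beats [x0]. *)
pose M : R := `|a + q x0 + b| / l + 1.
have M1 : 1 <= M by rewrite lerDr divr_ge0// ltW.
pose rho : R := M + enorm x + enorm x0.
have [|z _ zmin] := lsc_min (@compact_eball R n rho) _ gl g0.
  by exists x0 => /=; rewrite /rho; have := enorm_ge0 x; lra.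
have gx0 : g x0 = (a + q x0)%:E by rewrite /g x0a EFinD.
have x0K : enorm x0 <= rho by rewrite /rho; have := enorm_ge0 x; lra.
have gmin w : (g z <= g w)%E.
  have [|wrho] := leP (enorm w) rho; first exact: zmin.
  apply: (le_trans (zmin _ x0K)); rewrite gx0 /g.
  apply: (@le_trans _ _ ((- b) + q w)%:E); last by rewrite EFinD leeD2r.
  rewrite lee_fin.
  have Mw : M <= enorm (w - x).
    have := ler_enormD (w - x) x; rewrite subrK.
    by move: wrho; rewrite /rho; have := enorm_ge0 x0; lra.
  have : l * M <= q w.
    rewrite /q -sqr_enorm ler_wpM2l ?(ltW l0)//; apply: (le_trans Mw).
    by rewrite expr2 ler_peMl ?enorm_ge0//; lra.
  have -> : l * M = `|a + q x0 + b| + l by rewrite /M; field; rewrite gt_eqF.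
  by have := ler_norm (a + q x0 + b); lra.
have [c zc] : exists c, psi z = c%:E.
  have := gmin x0; rewrite gx0 /g; move: (psi0 z).
  by case: (psi z) => [c| |]// _ _; exists c.
exists z, c; split=> //.
  by have := gmin x0; rewrite gx0 /g zc lee_fin.
move=> w; have := psi0 w; case wd : (psi w) => [d| |]// _; last by rewrite leey.
rewrite lee_fin; apply/ler_addgt0Pl => e e0.
pose k : R := l * dot (w - z) (w - z).
have k0 : 0 <= k by rewrite mulr_ge0 ?dot_ge0// ltW.
pose t : R := Num.min 1 (e / (k + 1)).
have ek : 0 < e / (k + 1) by rewrite divr_gt0//; lra.
have t0 : 0 < t by rewrite lt_min ltr01.
have t1 : t <= 1 by rewrite ge_min lexx.
have tk : t * k <= e.
  have : t <= e / (k + 1) by rewrite ge_min lexx orbT.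
  rewrite ler_pdivlMr; last by lra.
  by move=> te; apply: le_trans te; rewrite ler_wpM2l ?(ltW t0)//; lra.
have t01 : 0 <= t <= 1 by rewrite ltW.
have pw : (psi w <= d%:E)%E by rewrite wd.
have pz : (psi z <= c%:E)%E by rewrite zc.
have := gmin (t *: w + (1 - t) *: z); rewrite {1}/g zc => h.
have {h} := le_trans h (leeD2r (q (t *: w + (1 - t) *: z))%:E
  (econvex_fin cpsi t01 pw pz)).
have -> : q (t *: w + (1 - t) *: z) = q z + t * (2 * l * dot (z - x) (w - z)) + t * (t * k).
  rewrite /q /k; have -> : t *: w + (1 - t) *: z - x = (z - x) + t *: (w - z).
    by apply/colP => i; rewrite !mxE; ring.
  move: (z - x) (w - z) => A B.
  by rewrite dotDl !dotDr !dotZl !dotZr (dotC B A); ring.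
rewrite -!EFinD lee_fin -(opprB z x) dotNl => h.
have : 0 <= t * (d + e - c - 2 * l * - dot (z - x) (w - z)).
  have : t * (t * k) <= t * e by rewrite ler_wpM2l// ltW.
  by lra.
by rewrite pmulr_rge0//; lra.
Qed.

End ConvexAnalysis.

(** * Minkowski symmetrals stay in [Conv_c] *)

Section Symmetral.
Context {R : realType} {n : nat}.
Implicit Types (psi phi : 'cV[R]_n -> \bar R) (x y z u : 'cV[R]_n).

Lemma refl_reflK u x : enorm u = 1 -> refl u (refl u x) = x.
Proof. by move=> u1; rewrite -!refl_mxE mulmxA refl_mxK// mul1mx. Qed.

(** With [a = 2y] and [b = R_u(2z)] the infimum runs over the representations of [x] as the midpoint
    of [a] and [R_u b], the form used from here on. *)
Lemma minkowski_symmetral_le psi u a b (c d : R) : enorm u = 1 ->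
  (psi a <= c%:E)%E -> (psi b <= d%:E)%E ->
  (minkowski_symmetral u psi (2^-1 *: (a + refl u b)) <= (2^-1 * (c + d))%:E)%E.
Proof.
move=> u1 ac bd; apply: ge_ereal_inf.
exists ((2^-1)%:E * psi a + (2^-1)%:E * psi b)%E; last first.
  by rewrite mulrDr EFinD !EFinM leeD// lee_wpmul2l// lee_fin.
exists (2^-1 *: a, 2^-1 *: refl u b); first exact: esym (scalerDr _ _ _).
by rewrite !scalerA divff// !scale1r refl_reflK.
Qed.

Lemma minkowski_symmetral_lt psi u x (c : R) : enorm u = 1 ->
  (forall y, -oo < psi y)%E -> (minkowski_symmetral u psi x < c%:E)%E ->
  exists a b (d e : R), [/\ psi a = d%:E, psi b = e%:E,
    x = 2^-1 *: (a + refl u b) & 2^-1 * (d + e) < c].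
Proof.
move=> u1 psi0 /ereal_inf_lt[_ [[y z] /= yzx <-]].
set a := 2 *: y; set b := refl u (2 *: z).
have xE : x = 2^-1 *: (a + refl u b).
  by rewrite refl_reflK// -scalerDr scalerA mulVf// scale1r.
have := psi0 b; have := psi0 a.
case ad : (psi a) => [d| |]// _; case be : (psi b) => [e| |]// _.
- rewrite -!EFinM -EFinD lte_fin => h; exists a, b, d, e; split=> //.
  by rewrite mulrDr.
- by rewrite gt0_muley ?lte_fin ?invr_gt0// addey// ltNge leey.
- by rewrite gt0_muley ?lte_fin ?invr_gt0// addye// ltNge leey.
- by rewrite gt0_muley ?lte_fin ?invr_gt0// addye// ltNge leey.
Qed.

Lemma minkowski_symmetral_ge psi u x (c : R) : enorm u = 1 ->
  (forall y, -oo < psi y)%E ->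
  (forall a b (d e : R), psi a = d%:E -> psi b = e%:E ->
    x = 2^-1 *: (a + refl u b) -> c <= 2^-1 * (d + e)) ->
  (c%:E <= minkowski_symmetral u psi x)%E.
Proof.
move=> u1 psi0 h; rewrite leNgt; apply/negP.
move=> /(minkowski_symmetral_lt u1 psi0)[a [b [d [e [ad be xE]]]]].
by rewrite ltNge (h a b d e).
Qed.

Lemma growth_gtNy psi (s b : R) :
  (forall x, ((s * enorm x - b)%:E <= psi x)%E) -> forall x, (-oo < psi x)%E.
Proof. by move=> sb x; apply: lt_le_trans (sb x); rewrite ltNyr. Qed.

Lemma growth_ge psi (s b : R) : 0 < s ->
  (forall x, ((s * enorm x - b)%:E <= psi x)%E) ->
  forall x, ((- b)%:E <= psi x)%E.
Proof.
move=> s0 sb x; apply: le_trans (sb x); rewrite lee_fin lerDr.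
by rewrite mulr_ge0 ?enorm_ge0// ltW.
Qed.

Lemma minkowski_symmetral_growth psi u (s b : R) : enorm u = 1 -> 0 < s ->
  (forall x, ((s * enorm x - b)%:E <= psi x)%E) ->
  forall x, ((s * enorm x - b)%:E <= minkowski_symmetral u psi x)%E.
Proof.
move=> u1 s0 sb x; apply: minkowski_symmetral_ge => //; first exact: growth_gtNy sb.
move=> a a' d d' ad ad' ->.
have := sb a; have := sb a'; rewrite ad ad' !lee_fin enormZ ger0_norm ?invr_ge0//.
have := ler_enormD a (refl u a').
rewrite -[refl u a']refl_mxE enorm_orthogonal; last exact: orthogonal_refl.
move=> h h1 h2; have : s * enorm (a + refl_mx u *m a') <= s * (enorm a + enorm a').
  by rewrite ler_wpM2l// ltW.
by lra.
Qed.

Lemma minkowski_symmetral_convex psi u : enorm u = 1 ->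
  (forall y, -oo < psi y)%E -> (forall x, -oo < minkowski_symmetral u psi x)%E ->
  econvex psi -> econvex (minkowski_symmetral u psi).
Proof.
move=> u1 psi0 tau0 cpsi; apply: econvex_of_lt => // x y t c d t01.
move=> /(minkowski_symmetral_lt u1 psi0)[a [b [a' [b' [ha hb -> ha']]]]].
move=> /(minkowski_symmetral_lt u1 psi0)[e [f [e' [f' [he hf -> he']]]]].
have le_fin g (r : R) : psi g = r%:E -> (psi g <= r%:E)%E by move=> ->.
have hae := econvex_fin cpsi t01 (le_fin _ _ ha) (le_fin _ _ he).
have hbf := econvex_fin cpsi t01 (le_fin _ _ hb) (le_fin _ _ hf).
have -> : t *: (2^-1 *: (a + refl u b)) + (1 - t) *: (2^-1 *: (e + refl u f)) =
    2^-1 *: ((t *: a + (1 - t) *: e) + refl u (t *: b + (1 - t) *: f)).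
  rewrite -!refl_mxE mulmxDr -!scalemxAr.
  by apply/colP => i; rewrite !mxE; ring.
apply: (le_trans (minkowski_symmetral_le u1 hae hbf)); rewrite lee_fin.
have /andP[t0 t1] := t01.
have : t * (2^-1 * (a' + b')) <= t * c by rewrite ler_wpM2l// ltW.
have : (1 - t) * (2^-1 * (e' + f')) <= (1 - t) * d.
  by rewrite ler_wpM2l ?subr_ge0// ltW.
by lra.
Qed.

(** By growth only the [a] in a fixed ball can give a value below the threshold; on that compact
    ball, the strict inequality at [x] extends to a common neighbourhood of [x]. *)
Lemma minkowski_symmetral_lsc psi u (s b : R) : enorm u = 1 -> 0 < s ->
  (forall x, ((s * enorm x - b)%:E <= psi x)%E) -> lower_semicontinuous psi ->
  lower_semicontinuous (minkowski_symmetral u psi).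
Proof.
move=> u1 s0 sb lpsi x c /EFin_lt_mid[c' cc' c'x].
have psi0 := growth_gtNy sb.
pose h (p : 'cV[R]_n * 'cV[R]_n) := refl_mx u *m (2 *: p.1 - p.2).
have hc : continuous h.
  have c1 : continuous (fun p : 'cV[R]_n * 'cV[R]_n => 2 *: p.1 - p.2).
    apply: addmx_continuous => p.
      by apply: cvgZr; exact: cvg_fst.
    by apply: cvgN; exact: cvg_snd.
  move=> p; exact: (continuous_comp (c1 p) (mulmx_continuousl (M := refl_mx u) (x := _))).
pose f (p : 'cV[R]_n * 'cV[R]_n) := (psi p.2 + psi (h p))%E.
have fl : lower_semicontinuous f.
  apply: (lscD (f := psi \o snd) (g := psi \o h)) => //.
  - by move=> p; exact: psi0.
  - by move=> p; exact: psi0.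
  - by apply: lsc_comp => // p; exact: cvg_snd.
  - exact: lsc_comp.
(* For [|a| > rho] growth gives [psi a > 2c' + b], and the other term is at least [-b]. *)
pose rho : R := (2 * c' + 2 * b) / s.
have /compact_near_coveringP cK := @compact_eball R n rho.
have xE v a a' : v = 2^-1 *: (a + refl u a') -> a' = refl_mx u *m (2 *: v - a).
  move=> ->; rewrite scalerA divff// scale1r addrAC subrr add0r.
  by rewrite refl_mxE refl_reflK.
pose V := [set v | [set a : 'cV[R]_n | enorm a <= rho] `<=`
  (fun a => ((2 * c')%:E < f (v, a))%E)].
have xV : nbhs x V.
  apply: (cK _ (nbhs x) (fun v a => ((2 * c')%:E < f (v, a))%E)) => a _.
  have : ((2 * c')%:E < f (x, a))%E.
    have := psi0 (h (x, a)); have := psi0 a; rewrite /f /=.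
    case ad : (psi a) => [d| |]// _; case ae : (psi (h (x, a))) => [e| |]// _;
      rewrite ?addey ?addye ?ltry//.
    rewrite -EFinD lte_fin.
    have le_fin g (r : R) : psi g = r%:E -> (psi g <= r%:E)%E by move=> ->.
    have := minkowski_symmetral_le u1 (le_fin _ _ ad) (le_fin _ _ ae).
    rewrite -refl_mxE /h /= mulmxA refl_mxK// mul1mx addrC subrK scalerA mulVf//.
    by rewrite scale1r => /(lt_le_trans c'x); rewrite lte_fin; lra.
  move=> /fl[W xaW Wf].
  have [[W1 W2] /= [W1x W2a] W12] : nbhs (x, a) W by [].
  exists (W2, W1) => //= -[a' v] /= [W2a' W1v].
  by apply: Wf; apply: W12.
exists V => // v VP; apply: (@lt_le_trans _ _ c'%:E); first by rewrite lte_fin.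
apply: minkowski_symmetral_ge => // a a' d e ad ae /xE a'E.
have [arho|rhoa] := leP (enorm a) rho.
  have := VP _ arho; rewrite /f /h /= -a'E ad ae -EFinD lte_fin.
  by lra.
move: rhoa; rewrite ltr_pdivrMr// => rhoa.
have := sb a; rewrite ad lee_fin; have := growth_ge s0 sb a'; rewrite ae lee_fin.
by lra.
Qed.

Lemma minkowski_symmetral_Conv_c psi u (s b : R) : enorm u = 1 -> 0 < s ->
  (forall x, ((s * enorm x - b)%:E <= psi x)%E) -> Conv_c psi ->
  Conv_c (minkowski_symmetral u psi).
Proof.
move=> u1 s0 sb [psi0 cpsi lpsi [x px] copsi].
have tsb := minkowski_symmetral_growth u1 s0 sb.
have tau0 := growth_gtNy tsb.
split=> //.
- exact: minkowski_symmetral_convex.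
- exact: minkowski_symmetral_lsc sb lpsi.
- have [a xa] : exists a : R, (psi x <= a%:E)%E.
    by move: (psi0 x) px; case: (psi x) => [r| |]//; exists r.
  exists (2^-1 *: (x + refl u x)).
  have := minkowski_symmetral_le u1 xa xa; case: (minkowski_symmetral _ _ _) => //.
- exact: growth_coercive tsb.
Qed.

End Symmetral.

(** * Legendre conjugation and biconjugation *)

Section Conjugate.
Context {R : realType} {n : nat}.
Implicit Types (psi phi : 'cV[R]_n -> \bar R) (x y z u v : 'cV[R]_n).

Lemma le_legendre phi x y (c : R) : (phi y <= c%:E)%E ->
  ((dot x y - c)%:E <= legendre phi x)%E.
Proof.
move=> yc; apply: le_ereal_sup_tmp; exists ((dot x y)%:E - phi y)%E.
  by exists y.
by rewrite EFinB leeB.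
Qed.

Lemma legendre_lt phi x (c : R) : (forall y, -oo < phi y)%E ->
  (c%:E < legendre phi x)%E -> exists y d, phi y = d%:E /\ c < dot x y - d.
Proof.
move=> phi0 /ereal_sup_gt[_ [y _ <-]]; have := phi0 y.
by case yd : (phi y) => [d| |]// _; rewrite -EFinB lte_fin => h; exists y, d.
Qed.

Lemma legendre_le phi x (c : R) :
  (forall y, ((dot x y - c)%:E <= phi y)%E) -> (legendre phi x <= c%:E)%E.
Proof.
move=> h; apply: ge_ereal_sup => _ [y _ <-]; have := h y.
case: (phi y) => [d| |]//=; last by rewrite leNye.
by rewrite -EFinB !lee_fin; lra.
Qed.

Lemma Fenchel_Young phi x y (c : R) : (legendre phi x <= c%:E)%E ->
  ((dot x y - c)%:E <= phi y)%E.
Proof.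
move=> h; have := le_trans (ereal_sup_ubound (imageT _ y)) h.
case: (phi y) => [d| |]//=; last by rewrite leey.
by rewrite -EFinB !lee_fin; lra.
Qed.

(** If the biconjugate at [x] were at most [c < phi x], the slope certified by [prox] would bound it
    below by [d + 2k|x - z|^2] with [d = phi z]. Then [d <= c], while large [k] forces [z] into the
    neighbourhood of [x] where [phi > c]. *)
Lemma Fenchel_Moreau phi (b : R) : econvex phi -> lower_semicontinuous phi ->
  Defs.proper phi -> (forall y, (- b)%:E <= phi y)%E ->
  legendre (legendre phi) = phi.
Proof.
move=> cphi lphi [x0 px0] phib.
have phi0 y : (-oo < phi y)%E by apply: lt_le_trans (phib y); rewrite ltNyr.
have [a x0a] : exists a, phi x0 = a%:E.
  by move: (phi0 x0) px0; case: (phi x0) => [r| |]//; exists r.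
apply/funext => x; apply/eqP; rewrite eq_le; apply/andP; split.
  move: (phi0 x); case xd : (phi x) => [d| |]// _; last by rewrite leey.
  apply: legendre_le => p; rewrite dotC; apply: le_legendre; by rewrite xd.
rewrite leNgt; apply/negP => hlt.
have [c [cx cphix]] : exists c : R,
    (legendre (legendre phi) x <= c%:E)%E /\ (c%:E < phi x)%E.
  move: hlt; case: (legendre (legendre phi) x) => [r| |].
  - by exists r.
  - by rewrite ltNge leey.
  - case: (phi x) (phi0 x) => [d| |]// _ _; last by exists 0; rewrite leNye ltry.
    by exists (d - 1); rewrite leNye lte_fin; split=> //; lra.
have [V xV Vphi] := lphi _ _ cphix.
have [e /= e0 eV] : nbhs_ball x V by rewrite nbhs_ballE.
(* Turns [k |x - z|^2 < |c + b| + 1] into [|x - z| < e]. *)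
pose k : R := (`|c + b| + 1) / e ^+ 2.
have k0 : 0 < k by rewrite divr_gt0 ?exprn_gt0//; have := normr_ge0 (c + b); lra.
have [z [d [zd _ zP]]] := prox x cphi lphi phib x0a k0.
pose p := (2 * k) *: (x - z).
have pd : (legendre phi p <= (dot p z - d)%:E)%E.
  apply: legendre_le => w; apply: le_trans (zP w); rewrite lee_fin /p !dotZl dotBr.
  by lra.
have := le_trans (le_legendre x pd) cx; rewrite lee_fin => h.
have dE : dot x p - (dot p z - d) = d + 2 * k * dot (x - z) (x - z).
  by rewrite (dotC x p) /p !dotZl (dotBr (x - z)); ring.
have q0 := dot_ge0 (x - z).
have kq0 : 0 <= k * dot (x - z) (x - z) by rewrite mulr_ge0// ltW.
have zV : V z.
  apply: eV; rewrite -ball_normE /=; apply: (le_lt_trans (ler_norm_enorm _)).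
  rewrite -(@ltr_pXn2r _ 2) ?nnegrE ?enorm_ge0 ?(ltW e0)// sqr_enorm.
  have := phib z; rewrite zd lee_fin => bd.
  have : k * dot (x - z) (x - z) < `|c + b| + 1.
    by have := ler_norm (c + b); rewrite dE in h; lra.
  by rewrite /k mulrAC ltr_pdivrMr ?exprn_gt0// ltr_pM2l//; have := normr_ge0 (c + b); lra.
have := Vphi _ zV; rewrite zd lte_fin; rewrite dE in h; lra.
Qed.

Lemma legendre_convex phi : (forall y, -oo < phi y)%E ->
  (forall x, -oo < legendre phi x)%E -> econvex (legendre phi).
Proof.
move=> phi0 L0; apply: econvex_of_lt => // x y t c d /andP[t0 t1] xc yd.
apply: legendre_le => w.
have := Fenchel_Young w (ltW xc); have := Fenchel_Young w (ltW yd).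
case: (phi w) => [v| |]//=; last by move=> _ _; rewrite leey.
rewrite !lee_fin dotDl !dotZl => h1 h2.
have : t * (dot x w - c) <= t * v by rewrite ler_wpM2l.
have : (1 - t) * (dot y w - d) <= (1 - t) * v by rewrite ler_wpM2l ?subr_ge0.
by lra.
Qed.

Lemma legendre_lsc phi : (forall y, -oo < phi y)%E ->
  lower_semicontinuous (legendre phi).
Proof.
move=> phi0 x c /(legendre_lt phi0)[y [d [yd cd]]].
exists [set v | c + d < dot v y].
  apply: open_nbhs_nbhs; split; last by rewrite /=; lra.
  have -> : [set v | c + d < dot v y] = dot y @^-1` [set r | c + d < r].
    by apply/seteqP; split=> v /=; rewrite dotC.
  by apply: open_comp => [v _|]; [exact: dot_continuousr|exact: open_gt].
move=> v /= cv; have yd' : (phi y <= d%:E)%E by rewrite yd.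
by apply: lt_le_trans (le_legendre v yd'); rewrite lte_fin; lra.
Qed.

End Conjugate.

Section TruncatedConjugate.
Context {R : realType} {n : nat}.
Implicit Types (psi : 'cV[R]_n -> \bar R) (x y z v : 'cV[R]_n).

(* The conjugate of [psi] restricted to the ball of radius [N]; it is the junk
   value [sup set0 = 0] when the ball misses the domain of [psi]. *)
Definition tconj psi (N : R) y : R :=
  sup [set c | exists v d, [/\ enorm v <= N, psi v = d%:E & c = dot y v - d]].

Variables (psi : 'cV[R]_n -> \bar R) (x0 : 'cV[R]_n) (a b : R).
Hypothesis x0a : psi x0 = a%:E.
Hypothesis psib : forall x, ((- b)%:E <= psi x)%E.

Lemma tconj_le N y c : enorm x0 <= N ->
  (forall v d, enorm v <= N -> psi v = d%:E -> dot y v - d <= c) ->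
  tconj psi N y <= c.
Proof.
move=> x0N h; apply: ge_sup; first by exists (dot y x0 - a), x0, a.
by move=> _ [v [d [vN vd ->]]]; exact: h.
Qed.

Lemma le_tconj N y v d : enorm v <= N -> psi v = d%:E ->
  dot y v - d <= tconj psi N y.
Proof.
move=> vN vd; apply: ub_le_sup; last by exists v, d.
exists (enorm y * N + b) => _ [w [e [wN we ->]]].
have := psib w; rewrite we lee_fin => be.
have := Cauchy_Schwarz y w.
have : enorm y * enorm w <= enorm y * N by rewrite ler_wpM2l ?enorm_ge0.
by lra.
Qed.

Lemma tconj_lt N y c : enorm x0 <= N -> c < tconj psi N y ->
  exists v d, [/\ enorm v <= N, psi v = d%:E & c < dot y v - d].
Proof.
move=> x0N; rewrite ltNge => cy; apply: contrapT => h; move/negP: cy; apply.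
apply: tconj_le => // v d vN vd; rewrite leNgt; apply/negP => cd; apply: h.
by exists v, d.
Qed.

Lemma tconj_mono N M y : enorm x0 <= N -> N <= M ->
  tconj psi N y <= tconj psi M y.
Proof.
move=> x0N NM; apply: tconj_le => // v d vN; apply: le_tconj.
exact: le_trans NM.
Qed.

Lemma tconj_lip N y z : enorm x0 <= N ->
  `|tconj psi N y - tconj psi N z| <= N * enorm (y - z).
Proof.
move=> x0N.
have h y' z' : tconj psi N y' <= tconj psi N z' + N * enorm (y' - z').
  apply: tconj_le => // v d vN vd; have := le_tconj z' vN vd.
  have := Cauchy_Schwarz (y' - z') v; rewrite dotBl.
  have : enorm (y' - z') * enorm v <= enorm (y' - z') * N.
    by rewrite ler_wpM2l ?enorm_ge0.
  by lra.
have := h y z; have := h z y; rewrite -(opprB y z) enormN ler_norml.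
by move=> ? ?; apply/andP; split; lra.
Qed.

Lemma tconj_convex N y z t : enorm x0 <= N -> 0 <= t <= 1 ->
  tconj psi N (t *: y + (1 - t) *: z) <=
  t * tconj psi N y + (1 - t) * tconj psi N z.
Proof.
move=> x0N /andP[t0 t1]; apply: tconj_le => // v d vN vd.
have := le_tconj y vN vd; have := le_tconj z vN vd; rewrite dotDl !dotZl => hz hy.
have : t * (dot y v - d) <= t * tconj psi N y by rewrite ler_wpM2l.
have : (1 - t) * (dot z v - d) <= (1 - t) * tconj psi N z.
  by rewrite ler_wpM2l ?subr_ge0.
by lra.
Qed.

Lemma tconj_cvg N y : enorm x0 <= N ->
  (tconj psi (N + i%:R) y)%:E @[i --> \oo] --> legendre psi y.
Proof.
move=> x0N.
have x0Ni i : enorm x0 <= N + i%:R by rewrite (le_trans x0N)// lerDl.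
have -> : legendre psi y =
    ereal_sup (range (fun i : nat => (tconj psi (N + i%:R) y)%:E)).
  apply/eqP; rewrite eq_le; apply/andP; split.
    apply: ge_ereal_sup => _ [v _ <-]; have := psib v.
    case vd : (psi v) => [d| |]//= _; last by rewrite leNye.
    pose i := (Num.truncn (enorm v)).+1.
    apply: le_ereal_sup_tmp; exists (tconj psi (N + i%:R) y)%:E; first by exists i.
    rewrite -EFinB lee_fin; apply: le_tconj => //.
    have := truncnS_gt (enorm v); rewrite -/i => /ltW/le_trans; apply.
    by rewrite lerDr (le_trans (enorm_ge0 x0)).
  apply: ge_ereal_sup => _ [i _ <-]; rewrite leNgt; apply/negP.
  move=> h; have [c [hc ci]] : exists c,
      (legendre psi y <= c%:E)%E /\ c < tconj psi (N + i%:R) y.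
    move: h; case: (legendre psi y) => [r| |]//; rewrite ?lte_fin => h.
      by exists r.
    by exists (tconj psi (N + i%:R) y - 1); rewrite leNye; split=> //; lra.
  have [v [d [_ vd cd]]] := tconj_lt (x0Ni i) ci.
  by have := Fenchel_Young v hc; rewrite vd lee_fin; lra.
apply: ereal_nondecreasing_cvgn => i j ij; rewrite lee_fin.
by apply: tconj_mono => //; rewrite lerD2l ler_nat.
Qed.

End TruncatedConjugate.

(** * Haar means of Lipschitz functions as limits of averages *)

Section LimitAverages.
Context {R : realType} {n : nat}.
Variables (eta : probability (borel_matrix R n) R).
Hypothesis haar : haar_probability eta.
Local Notation O := (@orthogonal_group R n).
Variables (r : nat -> 'M[R]_n) (m : nat).
Hypothesis Or : forall i, O (r i).
Hypothesis m_gt0 : (0 < m)%N.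
Hypothesis perr : forall i, r (m + i)%N = r i.
Hypothesis symr : forall i, (r i)^T = r i.
Hypothesis genr : closed_subgroup_generated (range r) = O.

Section Function.
Variables (f : 'cV[R]_n -> R) (N : R).
Hypothesis N0 : 0 <= N.
Hypothesis lf : forall y z, `|f y - f z| <= N * enorm (y - z).

(** [t^T] is the inverse on O(n) and is continuous on all matrices; for Lipschitz [f] the integral
    is finite, so [fine] loses nothing. *)
Definition haar_mean (y : 'cV[R]_n) : R :=
  fine (\int[eta]_(t in O) (f (t^T *m y))%:E)%E.

Let fc : continuous f. Proof. exact: enorm_lip_continuous lf. Qed.

(** This is the uniform convergence on the group for the orbit map [A |-> f (A *m y)]. Rotations
    preserve norms, so its two-sided Lipschitz constant depends only on [N], [n] and [|y|]. *)
Lemma lavg_cvg_haar_mean y e : 0 < e -> exists K, forall k A, (K <= k)%N ->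
  O A -> `|lavg r f k (A *m y) - haar_mean y| <= e.
Proof.
move=> e0; pose H (A : 'M[R]_n) := f (A *m y).
have Hc : continuous H.
  move=> A; exact: (continuous_comp (mulmx_continuousr (M := y) (x := A)) (fc (x := _))).
have lipH A B C D : O A -> O B -> O C -> O D ->
    `|H (C *m A *m D) - H (C *m B *m D)| <= N * (n%:R ^+ 2 * enorm y) * `|A - B|.
  move=> _ _ OC OD; apply: (le_trans (lf _ _)); rewrite -mulrA ler_wpM2l//.
  rewrite (_ : _ - _ = C *m ((A - B) *m (D *m y))); last first.
    by rewrite mulmxBl mulmxBr !mulmxA.
  rewrite (enorm_orthogonal _ OC).
  by apply: (le_trans (ler_enorm_mulmx _ _)); rewrite (enorm_orthogonal _ OD).
have L0 : 0 <= N * (n%:R ^+ 2 * enorm y).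
  by rewrite !mulr_ge0 ?enorm_ge0.
have [K KP] := lavg_cvg_haar haar Or m_gt0 perr symr genr L0 Hc lipH e0.
by exists K => k A Kk OA; have := KP k A Kk OA; rewrite /H lavg_comp.
Qed.

Lemma cvg_haar_mean y : lavg r f k y @[k --> \oo] --> haar_mean y.
Proof.
apply/cvgrPdist_le => e e0; have [K KP] := lavg_cvg_haar_mean y e0.
exists K => // k /= Kk; rewrite distrC -{1}(mul1mx y); apply: KP => //.
exact: orthogonal1.
Qed.

Arguments cvg_haar_mean : clear implicits.

(** The averages along the orbit of [y] started at [A] and those of [A *m y] started at the identity
    are the same numbers; uniformity in the start identifies their limits. *)
Lemma haar_mean_radial A y : O A -> haar_mean (A *m y) = haar_mean y.
Proof.
move=> OA; apply/eqP; rewrite -subr_eq0 -normr_le0; apply/ler_addgt0Pl => e e0.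
rewrite addr0; have e20 : 0 < e / 2 by rewrite divr_gt0.
have [K KP] := lavg_cvg_haar_mean y e20.
have [K' K'P] := lavg_cvg_haar_mean (A *m y) e20.
have := KP (maxn K K') A (leq_maxl _ _) OA.
have := K'P (maxn K K') 1%:M (leq_maxr _ _) (@orthogonal1 R n).
rewrite mul1mx !ler_norml => /andP[? ?] /andP[? ?].
by apply/andP; split; lra.
Qed.

Lemma lavg_lip k y z : `|lavg r f k y - lavg r f k z| <= N * enorm (y - z).
Proof.
elim: k y z => [|k IH] y z //=.
have := IH y z; have := IH (r k *m y) (r k *m z).
rewrite -mulmxBr enorm_orthogonal// => h1 h2.
rewrite -mulrBr opprD addrACA normrM ger0_norm ?invr_ge0//.
have := ler_normD (lavg r f k y - lavg r f k z)
  (lavg r f k (r k *m y) - lavg r f k (r k *m z)).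
by lra.
Qed.

Lemma haar_mean_lip y z : `|haar_mean y - haar_mean z| <= N * enorm (y - z).
Proof.
have h : `|lavg r f k y - lavg r f k z| @[k --> \oo] --> `|haar_mean y - haar_mean z|.
  by apply: cvg_norm; apply: cvgB; exact: cvg_haar_mean.
apply: (ler_cvg_to h (cvg_cst _)); near=> k; exact: lavg_lip.
Unshelve. all: by end_near. Qed.

Lemma haar_mean_continuous : continuous haar_mean.
Proof. exact: enorm_lip_continuous haar_mean_lip. Qed.

Lemma haar_mean_convex y z t : 0 <= t <= 1 ->
  (forall y z t, 0 <= t <= 1 ->
    f (t *: y + (1 - t) *: z) <= t * f y + (1 - t) * f z) ->
  haar_mean (t *: y + (1 - t) *: z) <= t * haar_mean y + (1 - t) * haar_mean z.
Proof.
move=> t01 cf.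
have h : t * lavg r f k y + (1 - t) * lavg r f k z @[k --> \oo] -->
    t * haar_mean y + (1 - t) * haar_mean z.
  by apply: cvgD; apply: cvgM; try exact: cvg_cst; exact: cvg_haar_mean.
apply: (ler_cvg_to (cvg_haar_mean _) h).
apply: nearW => k; elim: k y z {h} => [|k IH] y z /=; first exact: cf.
rewrite mulmxDr -!scalemxAr.
by have := IH y z; have := IH (r k *m y) (r k *m z); lra.
Qed.

Lemma haar_mean_le c y : (forall z, enorm z = enorm y -> f z <= c) ->
  haar_mean y <= c.
Proof.
move=> cf; apply: (ler_cvg_to (cvg_haar_mean y) (cvg_cst c)); apply: nearW => k.
apply: (lavg_le_cst (D := [set z | enorm z = enorm y])) => // i z /= <-.
exact: enorm_orthogonal.
Qed.

(** After time [K] every average is a mean of values of [lavg r f K] on the sphere through [y], so a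
    lower bound there survives in the limit. *)
Lemma haar_mean_ge_lavg c y K :
  (forall z, enorm z = enorm y -> c <= lavg r f K z) -> c <= haar_mean y.
Proof.
move=> cf; apply: (ler_cvg_to (cvg_cst c) (cvg_haar_mean y)).
exists K => // k /= /subnKC <-; rewrite lavg_shift.
apply: (lavg_ge_cst (D := [set z | enorm z = enorm y])) => // i z /= <-.
exact: enorm_orthogonal.
Qed.

End Function.
End LimitAverages.

(** * Epi-convergence of the iterates *)

(** Here [g] may be [+oo] and not integrable, so the sum is split through [g^+ + C = (g + C) + g^-],
    where [g^- <= C] has a finite integral. The shift makes monotone convergence applicable to
    functions that are only bounded below. *)
Lemma integral_shift {R : realType} d (T : measurableType d)
  (mu : {measure set T -> \bar R})  (D : set T) (g : T -> \bar R) (C : R) :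
  measurable D -> mu D = 1%E -> measurable_fun D g -> 0 <= C ->
  (forall t, D t -> ((- C)%:E <= g t)%E) ->
  (\int[mu]_(t in D) (g t + C%:E) = \int[mu]_(t in D) g t + C%:E)%E.
Proof.
move=> mD muD mg C0 gC.
have cC : (\int[mu]_(t in D) C%:E = C%:E)%E.
  by rewrite (integral_cst _ mD) muD mule1.
have mgp : measurable_fun D g^\+%E by exact: measurable_funepos.
have mgn : measurable_fun D g^\-%E by exact: measurable_funeneg.
have gC0 t : D t -> (0 <= g t + C%:E)%E.
  by move=> /gC h; rewrite -leeBlDr// sub0e -EFinN.
have mgC : measurable_fun D (fun t => g t + C%:E)%E.
  by apply: emeasurable_funD => //; exact: measurable_cst.
have gnC t : D t -> (g^\-%E t <= C%:E)%E.
  by move=> /gC; rewrite funenegE ge_max lee_fin C0 andbT leeNl.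
have E : (\int[mu]_(t in D) (g^\+ t + C%:E) =
    \int[mu]_(t in D) ((g t + C%:E) + g^\- t))%E.
  apply: eq_integral => t /set_mem Dt; rewrite {2}(funeposneg g) addeAC subeK//.
  by rewrite ge0_fin_numE ?funeneg_ge0//; apply: le_lt_trans (ltry C); exact: gnC.
rewrite [RHS]ge0_integralD// [LHS]ge0_integralD// cC in E.
rewrite [in RHS]integralE.
have fin : (\int[mu]_(t in D) g^\- t \is a fin_num)%E.
  rewrite ge0_fin_numE; last by apply: integral_ge0 => t _; exact: funeneg_ge0.
  apply: (@le_lt_trans _ _ C%:E); last by rewrite ltry.
  by rewrite -cC; apply: ge0_le_integral.
by rewrite addeAC E addeK.
Qed.

(** * The Haar mean of the conjugate and the candidate limit *)

Section Limit.
Context {R : realType} {n : nat}.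
Variables (eta : probability (borel_matrix R n) R).
Hypothesis haar : haar_probability eta.
Local Notation O := (@orthogonal_group R n).
Variables (r : nat -> 'M[R]_n) (m : nat).
Hypothesis Or : forall i, O (r i).
Hypothesis m_gt0 : (0 < m)%N.
Hypothesis perr : forall i, r (m + i)%N = r i.
Hypothesis symr : forall i, (r i)^T = r i.
Hypothesis genr : closed_subgroup_generated (range r) = O.
Variables (psi : 'cV[R]_n -> \bar R) (x0 : 'cV[R]_n) (a s b : R).
Hypothesis x0a : psi x0 = a%:E.
Hypothesis s0 : 0 < s.
Hypothesis psi_growth : forall x, ((s * enorm x - b)%:E <= psi x)%E.

Let psib : forall x, ((- b)%:E <= psi x)%E. Proof. exact: growth_ge psi_growth. Qed.
Let psi0 : forall x, (-oo < psi x)%E. Proof. exact: growth_gtNy psi_growth. Qed.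

Definition mean_legendre y : \bar R :=
  (\int[eta]_(t in O) legendre psi (invmx t *m y))%E.

(** Starting at [enorm x0] keeps [x0] in every ball, so no truncation takes the junk value. *)
Let N i : R := enorm x0 + i%:R.
Let x0N i : enorm x0 <= N i. Proof. by rewrite lerDl. Qed.
Let N0 i : 0 <= N i. Proof. exact: le_trans (enorm_ge0 _) (x0N i). Qed.
Let f i := tconj psi (N i).
Let lf i : forall y z, `|f i y - f i z| <= N i * enorm (y - z).
Proof. by move=> y z; apply: (tconj_lip x0a psib). Qed.
Let Fm i := haar_mean eta (f i).

Lemma measurable_legendre_rot (y : 'cV[R]_n) :
  measurable_fun (O : set (borel_matrix R n)) (fun t => legendre psi (t^T *m y)).
Proof.
apply: measurable_funTS; apply: lsc_measurable_borel.
apply: (lsc_comp (h := fun t : 'M[R]_n => t^T *m y)); last exact: legendre_lsc.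
move=> t; exact: (continuous_comp (trmx_continuous (x := t)) (mulmx_continuousr (x := _))).
Qed.

(** Truncations increase to the conjugate, so monotone convergence applies after a shift by [C], a
    bound that [x0] provides for all rotations at once. Monotonicity of the Haar means in [i] is
    read off from the averages. *)
Lemma mean_legendreE (y : 'cV[R]_n) : mean_legendre y = ereal_sup (range (fun i => (Fm i y)%:E)).
Proof.
have mO := @measurable_orthogonal R n.
have -> : mean_legendre y = (\int[eta]_(t in O) legendre psi (t^T *m y))%E.
  by apply: eq_integral => t /set_mem Ot; rewrite invmx_orthogonal.
pose C : R := `|enorm y * enorm x0| + `|a|.
have C0 : 0 <= C by rewrite addr_ge0.
have Cle i t : O t -> - C <= f i (t^T *m y).
  move=> Ot; apply: le_trans (le_tconj psib _ (x0N i) x0a).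
  have := Cauchy_Schwarz (t^T *m y) (- x0).
  rewrite dotNr enormN enorm_orthogonal; last exact: orthogonal_tr.
  have := ler_norm (enorm y * enorm x0); have := ler_norm a.
  by rewrite /C; lra.
have fc i : continuous (fun t : 'M[R]_n => f i (t^T *m y)).
  move=> t; have c1 := @enorm_lip_continuous _ _ (f i) (N i) (N0 i) (lf i).
  apply: (@continuous_comp _ _ _ (fun t : 'M[R]_n => t^T *m y)); last exact: c1.
  exact: (continuous_comp (trmx_continuous (x := t)) (mulmx_continuousr (x := _))).
have mf i : measurable_fun (O : set (borel_matrix R n))
    (fun t => (f i (t^T *m y))%:E).
  by apply: measurable_funTS; apply: lsc_measurable_borel; exact: continuous_lsc.
pose g i (t : borel_matrix R n) := ((f i (t^T *m y))%:E + C%:E)%E.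
have gi i : (\int[eta]_(t in O) g i t = (Fm i y)%:E + C%:E)%E.
  rewrite integral_shift//; [|exact: haar.1|by move=> t /(Cle i); rewrite lee_fin].
  congr (_ + _)%E; rewrite /Fm /haar_mean fineK//.
  by have := integrable_fin_num mO (integrable_borel haar (fc i)).
have ndf i j z : (i <= j)%N -> f i z <= f j z.
  by move=> ij; apply: (tconj_mono x0a psib) => //; rewrite lerD2l ler_nat.
have fleg z : (f i z)%:E @[i --> \oo] --> legendre psi z.
  exact: (tconj_cvg x0a psib).
have mg i : measurable_fun (O : set (borel_matrix R n)) (g i).
  by apply: emeasurable_funD; [exact: mf|exact: measurable_cst].
have g_ge0 i t : O t -> (0 <= g i t)%E.
  by move=> /(Cle i); rewrite /g -EFinD lee_fin; lra.
have nd_g t : O t -> {homo g ^~ t : i j / (i <= j)%N >-> (i <= j)%E}.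
  by move=> _ i j ij; rewrite /g leeD2r// lee_fin ndf.
have := @cvg_monotone_convergence _ (borel_matrix R n) R eta O mO g mg g_ge0 nd_g.
have -> : (\int[eta]_(t in O) (fun t => limn (g ^~ t)) t =
    \int[eta]_(t in O) legendre psi (t^T *m y) + C%:E)%E.
  rewrite -integral_shift//; [|exact: haar.1|exact: measurable_legendre_rot|].
    apply: eq_integral => t _; apply/cvg_lim => //.
    by apply: cvgeD => //; [exact: fin_num_adde_defl|exact: cvg_cst].
  move=> t Ot; apply: le_trans (le_legendre _ (y := x0) (c := a) _); last by rewrite x0a.
  have := Cle 0%N t Ot; rewrite lee_fin => _.
  have := Cauchy_Schwarz (t^T *m y) (- x0).
  rewrite dotNr enormN enorm_orthogonal; last exact: orthogonal_tr.
  have := ler_norm (enorm y * enorm x0); have := ler_norm a.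
  by rewrite /C; lra.
move=> h.
have h2 : (Fm i y)%:E @[i --> \oo] -->
    (\int[eta]_(t in O) legendre psi (t^T *m y))%E.
  have -> : (fun i => (Fm i y)%:E) = (fun i => (\int[eta]_(t in O) g i t) + (- C)%:E)%E.
    by apply/funext => i; rewrite gi EFinN addeK.
  rewrite -[X in _ --> X](addeK (x := C%:E))//.
  by apply: cvgeD; [exact: fin_num_adde_defl|exact: h|exact: cvg_cst].
suff h3 : (Fm i y)%:E @[i --> \oo] --> ereal_sup (range (fun i => (Fm i y)%:E)).
  exact: (cvg_unique (@ereal_hausdorff R) h2 h3).
apply: ereal_nondecreasing_cvgn => i j ij.
have ci := cvg_haar_mean haar Or m_gt0 perr symr genr (N0 i) (lf i) (y := y).
have cj := cvg_haar_mean haar Or m_gt0 perr symr genr (N0 j) (lf j) (y := y).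
rewrite lee_fin; apply: (ler_cvg_to ci cj).
apply: nearW => k; apply: (lavg_mono (D := setT)) => // z _; exact: ndf.
Qed.

Let cvgF i y : lavg r (f i) k y @[k --> \oo] --> Fm i y.
Proof. exact: (cvg_haar_mean haar Or m_gt0 perr symr genr (N0 i) (lf i)). Qed.

Let Fm_radial i A y : O A -> Fm i (A *m y) = Fm i y.
Proof. exact: (haar_mean_radial haar Or m_gt0 perr symr genr (N0 i) (lf i)). Qed.

Let Fm_convex i y z t : 0 <= t <= 1 ->
  Fm i (t *: y + (1 - t) *: z) <= t * Fm i y + (1 - t) * Fm i z.
Proof.
move=> t01.
apply: (haar_mean_convex haar Or m_gt0 perr symr genr (N0 i) (lf i)) => //.
by move=> y' z' t' t01'; exact: (tconj_convex x0a psib).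
Qed.

Let FmN i y : Fm i (- y) = Fm i y.
Proof.
have ON : O (- 1%:M).
  by rewrite /orthogonal_group /= linearN /= trmx1 mulNmx mulmxN mulmx1 opprK.
by rewrite -(Fm_radial i y ON) mulNmx mul1mx.
Qed.

(** [t y] is the convex combination of [y] and [-y] with weight [(1 + t) / 2] on [y], and [Fm i] is
    even. *)
Let Fm_shrink i y t : 0 <= t <= 1 -> Fm i (t *: y) <= Fm i y.
Proof.
move=> t01; have h : 0 <= (1 + t) / 2 <= 1 by lra.
have := Fm_convex i y (- y) h; rewrite FmN scalerN -scaleNr -scalerDl.
by rewrite (_ : (1 + t) / 2 - (1 - (1 + t) / 2) = t); lra.
Qed.

Let le_mean_legendre i y : ((Fm i y)%:E <= mean_legendre y)%E.
Proof. by rewrite mean_legendreE; apply: ereal_sup_ubound; exists i. Qed.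

Let mean_legendre_lt (c : R) y : (c%:E < mean_legendre y)%E ->
  exists i, c < Fm i y.
Proof.
by rewrite mean_legendreE => /ereal_sup_gt[_ [i _ <-]]; rewrite lte_fin; exists i.
Qed.

Let mean_legendre_le (c : R) y : (forall i, Fm i y <= c) ->
  (mean_legendre y <= c%:E)%E.
Proof.
move=> h; rewrite mean_legendreE; apply: ge_ereal_sup => _ [i _ <-].
by rewrite lee_fin.
Qed.

Let Fm_le_fin i y (c : R) : (mean_legendre y <= c%:E)%E -> Fm i y <= c.
Proof. by move=> h; rewrite -lee_fin; exact: le_trans (le_mean_legendre i y) h. Qed.

Lemma mean_legendre_radial A y : O A -> mean_legendre (A *m y) = mean_legendre y.
Proof.
move=> OA; rewrite !mean_legendreE; do 2 f_equal.
by apply/funext => i; rewrite Fm_radial.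
Qed.

Lemma mean_legendre_lb y : ((Fm 0%N 0)%:E <= mean_legendre y)%E.
Proof.
apply: le_trans (le_mean_legendre 0 y); rewrite lee_fin.
by rewrite -(scale0r y); apply: Fm_shrink; rewrite lexx ler01.
Qed.

Let mean_legendre_gtNy y : (-oo < mean_legendre y)%E.
Proof. exact: lt_le_trans (ltNyr _) (mean_legendre_lb y). Qed.

Let small_le z v e : enorm z <= s -> psi v = e%:E -> dot z v - e <= b.
Proof.
move=> zs ve; have := psi_growth v; rewrite ve lee_fin.
have := Cauchy_Schwarz z v.
have : enorm z * enorm v <= s * enorm v by rewrite ler_wpM2r ?enorm_ge0.
by lra.
Qed.

Lemma mean_legendre_small y : enorm y <= s -> (mean_legendre y <= b%:E)%E.
Proof.
move=> ys; apply: mean_legendre_le => i.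
apply: (haar_mean_le haar Or m_gt0 perr symr genr (N0 i) (lf i)) => z zy.
by apply: (tconj_le x0a) => // v e _; apply: small_le; rewrite zy.
Qed.

Lemma mean_legendre_convex : econvex mean_legendre.
Proof.
apply: econvex_of_lt => // y z t c d t01 yc zd; apply: mean_legendre_le => i.
apply: (le_trans (Fm_convex i y z t01)); have /andP[t0 t1] := t01.
by rewrite lerD// ler_wpM2l ?subr_ge0//; apply: Fm_le_fin; exact: ltW.
Qed.

Lemma mean_legendre_lsc : lower_semicontinuous mean_legendre.
Proof.
move=> y c /mean_legendre_lt[i ci]; exists [set z | c < Fm i z]; last first.
  by move=> z /= cz; apply: lt_le_trans (le_mean_legendre i z); rewrite lte_fin.
have Fc : continuous (Fm i).
  exact: (haar_mean_continuous haar Or m_gt0 perr symr genr (N0 i) (lf i)).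
apply: open_nbhs_nbhs; split => //.
have -> : [set z | c < Fm i z] = Fm i @^-1` [set x | c < x] by [].
by apply: open_comp => [z _|]; [exact: Fc|exact: open_gt].
Qed.

Lemma mean_legendre_proper : Defs.proper mean_legendre.
Proof.
exists 0; have : (mean_legendre 0 <= b%:E)%E.
  by apply: mean_legendre_small; rewrite enorm0 ltW.
by case: (mean_legendre 0).
Qed.

Definition symmetrization := legendre mean_legendre.

Lemma legendre_symmetrization : legendre symmetrization = mean_legendre.
Proof.
apply: (@Fenchel_Moreau _ _ _ (- Fm 0%N 0)).
- exact: mean_legendre_convex.
- exact: mean_legendre_lsc.
- exact: mean_legendre_proper.
- by move=> y; rewrite opprK; exact: mean_legendre_lb.
Qed.

(** A conjugate bounded by [b] on the ball of radius [s] is dual to growth [s|x| - b]; testing with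
    the vector of length [s] along [x] gives the same constants as for [psi]. *)
Lemma symmetrization_growth x : ((s * enorm x - b)%:E <= symmetrization x)%E.
Proof.
have [x0'|xn0] := eqVneq (enorm x) 0.
  rewrite (enorm_eq0 x0') enorm0 mulr0 sub0r.
  apply: le_trans (le_legendre 0 (y := 0) (c := b) _).
    by rewrite lee_fin dot0l sub0r.
  by apply: mean_legendre_small; rewrite enorm0 ltW.
have {}xn0 : 0 < enorm x by rewrite lt0r xn0 enorm_ge0.
apply: le_trans (le_legendre x (y := (s / enorm x) *: x) (c := b) _).
  by rewrite lee_fin dotZr -sqr_enorm expr2 mulrA divfK// gt_eqF.
apply: mean_legendre_small; rewrite enormZ ger0_norm; last first.
  by rewrite divr_ge0 ?enorm_ge0// ltW.
by rewrite divfK// gt_eqF.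
Qed.

Lemma symmetrization_Conv_c : Conv_c symmetrization.
Proof.
have gtNy := growth_gtNy symmetrization_growth.
split=> //.
- exact: legendre_convex.
- exact: legendre_lsc.
- exists 0; have : (symmetrization 0 <= (- Fm 0%N 0)%:E)%E.
    by apply: legendre_le => y; rewrite dot0l sub0r opprK mean_legendre_lb.
  by case: (symmetrization 0).
- exact: growth_coercive symmetrization_growth.
Qed.

Lemma symmetrization_radial : radial symmetrization.
Proof.
have le A x : O A -> (symmetrization (A *m x) <= symmetrization x)%E.
  move=> OA; apply: ge_ereal_sup => _ [y _ <-]; apply: ereal_sup_ubound.
  exists (A^T *m y) => //; rewrite -dot_mulmxl mean_legendre_radial//.
  exact: orthogonal_tr.
move=> A OA; apply/funext => x /=; apply/eqP; rewrite eq_le le//=.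
rewrite -[X in (symmetrization X <= _)%E]mul1mx -(mulmx1C OA) -mulmxA.
by apply: le; exact: orthogonal_tr.
Qed.

Lemma symmetrization_unique phi : Conv_c phi -> legendre phi = mean_legendre ->
  symmetrization = phi.
Proof.
move=> phiC phiE; have [s' [b' [s'0 g]]] := Conv_c_growth phiC.
have [_ cphi lphi pphi _] := phiC.
by rewrite /symmetrization -phiE; apply: Fenchel_Moreau (growth_ge s'0 g).
Qed.

(** * The iterates: dual bounds, exactness of truncation, liminf and recovery *)

Variables (v : nat -> 'cV[R]_n) (psi_ : nat -> 'cV[R]_n -> \bar R).
Hypothesis v1 : forall k, enorm (v k) = 1.
Hypothesis rE : forall k, r k = refl_mx (v k).
Hypothesis psiC : Conv_c psi.
Hypothesis psi_0 : psi_ 0%N = psi.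
Hypothesis psi_S : forall k, psi_ k.+1 = minkowski_symmetral (v k) (psi_ k).

Lemma iter_growth k x : ((s * enorm x - b)%:E <= psi_ k x)%E.
Proof.
elim: k x => [|k IH] x; first by rewrite psi_0.
by rewrite psi_S; exact: minkowski_symmetral_growth.
Qed.

Lemma iter_Conv_c k : Conv_c (psi_ k).
Proof.
elim: k => [|k IH]; first by rewrite psi_0.
by rewrite psi_S; exact: (minkowski_symmetral_Conv_c (v1 k) s0 (iter_growth k) IH).
Qed.

Let iter_gtNy k x : (-oo < psi_ k x)%E.
Proof. exact: growth_gtNy (iter_growth k) x. Qed.

(** The midpoint of [w] and its reflection neither leaves the ball nor has value above [a]. These
    points bound the minimizers in [iter_recovery] independently of [k]. *)
Lemma iter_point k : exists w c, [/\ enorm w <= enorm x0, psi_ k w = c%:E & c <= a].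
Proof.
elim: k => [|k [w [c [wx0 wc ca]]]]; first by exists x0, a; rewrite psi_0.
have wa : (psi_ k w <= a%:E)%E by rewrite wc lee_fin.
have := minkowski_symmetral_le (v1 k) wa wa; rewrite -psi_S.
set w' := 2^-1 *: _; rewrite (_ : 2^-1 * (a + a) = a); last by field.
have := iter_gtNy k.+1 w'; case w'd : (psi_ k.+1 w') => [d| |]// _.
rewrite lee_fin => da; exists w', d; split=> //.
rewrite enormZ ger0_norm ?invr_ge0//.
have := ler_enormD w (refl (v k) w).
rewrite -refl_mxE enorm_orthogonal; last exact: orthogonal_refl.
by lra.
Qed.

(** One half of the statement that conjugates of iterates are averages, kept free of infinite
    values: [g] has to dominate the conjugate only on a ball, and reflections preserve balls. *)
Lemma iter_dual_le (g : 'cV[R]_n -> R) rho :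
  (forall z, enorm z <= rho -> forall w, ((dot z w - g z)%:E <= psi w)%E) ->
  forall k z, enorm z <= rho -> forall w, ((dot z w - lavg r g k z)%:E <= psi_ k w)%E.
Proof.
move=> h; elim=> [|k IH] z zr w; first by rewrite psi_0; exact: h.
have rz : enorm (r k *m z) <= rho by rewrite enorm_orthogonal.
rewrite psi_S; apply: minkowski_symmetral_ge => // p q d e pd qe ->.
have := IH _ zr p; have := IH _ rz q; rewrite pd qe !lee_fin /=.
by rewrite dotZr dotDr -(refl_mxE (v k) q) -rE (dot_mulmxl (r k)) symr; lra.
Qed.

(** The other half: near-maximizers at [z] and at [r k *m z] combine, through a reflected midpoint,
    into one for the symmetral. *)
Lemma iter_dual_lt (g : 'cV[R]_n -> R) :
  (forall z c, c < g z -> exists w d, psi w = d%:E /\ c < dot z w - d) ->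
  forall k z c, c < lavg r g k z ->
  exists w d, psi_ k w = d%:E /\ c < dot z w - d.
Proof.
move=> h; elim=> [|k IH] z c; first by rewrite psi_0; exact: h.
rewrite /=; set p := lavg _ _ _ _; set q := lavg _ _ _ _ => cpq.
pose e := 2^-1 * (p + q) - c.
have [|w1 [d1 [w1d h1]]] := IH z (p - e); first by rewrite /e -/p; lra.
have [|w2 [d2 [w2d h2]]] := IH (r k *m z) (q - e); first by rewrite /e -/q; lra.
have le1 : (psi_ k w1 <= d1%:E)%E by rewrite w1d.
have le2 : (psi_ k w2 <= d2%:E)%E by rewrite w2d.
have := minkowski_symmetral_le (v1 k) le1 le2; rewrite -psi_S.
set w := 2^-1 *: _.
have := iter_gtNy k.+1 w; case wd : (psi_ k.+1 w) => [d| |]// _.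
rewrite lee_fin => hd; exists w, d; split=> //.
rewrite (dot_mulmxl (r k)) symr in h2.
rewrite /w dotZr dotDr -(refl_mxE (v k)) -rE.
by rewrite /e in h1 h2; lra.
Qed.

(* A bound for the conjugate of [psi] on a ball confines, on any smaller ball,
   the points where it is attained. *)
Lemma tconj_exact rho rho' c : 0 <= rho -> rho < rho' ->
  (forall z w e, enorm z <= rho' -> psi w = e%:E -> dot z w - e <= c) ->
  exists i, forall z, enorm z <= rho -> forall w, ((dot z w - f i z)%:E <= psi w)%E.
Proof.
move=> rho0 rr h.
have x00 := enorm_ge0 x0.
(* From norm [M] on, a point contributes at most [c - (rho' - rho)|w|], as seen by pushing [z] along
   [w] into the larger ball; this does not exceed the value [- rho |x0| - a] guaranteed by [x0]. *)
pose M := `|c + rho * enorm x0 + a| / (rho' - rho).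
pose i := (Num.truncn M).+1; exists i => z zr w.
have := psi0 w; case we : (psi w) => [e| |]// _; last by rewrite leey.
rewrite lee_fin; have [wN|Nw] := leP (enorm w) (N i).
  by have := le_tconj psib z wN we; rewrite -/(f i); lra.
have rr0 : 0 < rho' - rho by rewrite subr_gt0.
have w0 : 0 < enorm w by apply: le_lt_trans Nw; exact: N0.
pose z' := z + ((rho' - rho) / enorm w) *: w.
have z'r : enorm z' <= rho'.
  apply: (le_trans (ler_enormD _ _)); rewrite enormZ ger0_norm; last first.
    by rewrite divr_ge0// ltW.
  by rewrite divfK ?gt_eqF//; lra.
have := h z' w e z'r we.
rewrite dotDl dotZl -sqr_enorm expr2 mulrA divfK ?gt_eqF// => h1.
have := le_tconj psib z (x0N i) x0a; rewrite -/(f i) => h2.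
have := Cauchy_Schwarz z (- x0); rewrite dotNr enormN => h3.
have : enorm z * enorm x0 <= rho * enorm x0 by rewrite ler_wpM2r.
have : c + rho * enorm x0 + a <= (rho' - rho) * enorm w.
  have Mw : M <= enorm w.
    apply/ltW; apply: (lt_trans (truncnS_gt M)); apply: le_lt_trans Nw.
    by rewrite lerDr.
  apply: (le_trans (ler_norm _)); move: Mw; rewrite /M ler_pdivrMr//; lra.
by lra.
Qed.

(* Every average over enough steps charges, with a fixed weight, the cap of
   directions close to [w]; there the conjugate exceeds its value at any point
   of the smaller ball. *)
Lemma mean_legendre_bound y (d t : R) : 0 < enorm y -> 0 <= t < 1 ->
  (mean_legendre y <= d%:E)%E ->
  exists c, forall z w e, enorm z <= t * enorm y -> psi w = e%:E ->
    dot z w - e <= c.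
Proof.
move=> y0 /andP[t0 t1] yd; set rho := enorm y.
(* A word within [delta] of [A] sends a point of norm [rho] to within [(1 - t) rho] of its image
   under [A]. *)
pose delta := (1 - t) / (n%:R ^+ 2 + 1).
have n20 : 0 <= n%:R ^+ 2 :> R by rewrite exprn_ge0.
have delta0 : 0 < delta by rewrite divr_gt0//; lra.
have [K /(_ K (leqnn K)) KP] := words_dense Or m_gt0 perr symr genr delta0.
pose p : R := 2^-1 ^+ K.
have p0 : 0 < p by rewrite exprn_gt0// invr_gt0.
have p1 : p <= 1 by rewrite exprn_ile1// ?invr_ge0// invf_le1// ler1n.
pose l := - (rho * enorm x0) - a.
(* The second entry solves [(1 - p) l + p v <= d] for [v], where [l] bounds every [f i] from below
   on the sphere; [b] serves the case [w = 0]. *)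
exists (Num.max b ((d - (1 - p) * l) / p)) => z w e zr we.
rewrite le_max; have [w0|w0] := eqVneq (enorm w) 0.
  have := psib w; rewrite we (enorm_eq0 w0) lee_fin dotC dot0l => h.
  by apply/orP; left; lra.
apply/orP; right; rewrite ler_pdivlMr//.
have {}w0 : 0 < enorm w by rewrite lt0r w0 enorm_ge0.
pose i := (Num.truncn (enorm w)).+1.
have wN : enorm w <= N i.
  by apply/ltW; apply: (lt_le_trans (truncnS_gt _)); rewrite lerDr enorm_ge0.
suff : (1 - p) * l + p * (dot z w - e) <= Fm i y.
  by have := Fm_le_fin i yd; lra.
apply: (haar_mean_ge_lavg haar Or m_gt0 perr symr genr (N0 i) (lf i) (K := K)).
move=> y' y'y; pose q := (rho / enorm w) *: w.
have qrho : enorm q = rho.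
  rewrite enormZ ger0_norm; first by rewrite divfK// gt_eqF.
  by rewrite divr_ge0// ltW.
have [|A OA Ay'] := @orthogonal_transitive R n y' q; first by rewrite qrho.
have [w' Kw' w'A] := KP A OA.
have rD j B : enorm B = rho -> enorm (r j *m B) = rho by rewrite enorm_orthogonal.
have lD B : enorm B = rho -> l <= f i B.
  move=> Brho; have := le_tconj psib B (x0N i) x0a; rewrite -/(f i).
  have := Cauchy_Schwarz B (- x0); rewrite dotNr enormN Brho /l; lra.
apply: le_trans (lavg_word_ge (D := [set B | enorm B = rho]) rD lD Kw' y'y).
rewrite -/p lerD2l ler_wpM2l ?(ltW p0)//.
apply: le_trans (le_tconj psib (w' *m y') wN we); rewrite lerD2r.
(* [w' *m y'] is close to [q], the point of the sphere in direction [w], so its pairing with [w] is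
   at least [t rho |w|], which dominates [<z, w>]. *)
have near : enorm (q - w' *m y') <= (1 - t) * rho.
  rewrite -Ay' -mulmxBl -(opprB w' A) mulNmx enormN.
  apply: (le_trans (ler_enorm_mulmx _ _)); rewrite y'y -/rho.
  have : `|w' - A| * (n%:R ^+ 2 + 1) <= 1 - t.
    by rewrite -ler_pdivlMr ?ltW//; lra.
  have := normr_ge0 (w' - A) => h0 h1.
  have h2 : n%:R ^+ 2 * `|w' - A| <= 1 - t by lra.
  have -> : n%:R ^+ 2 * rho * `|w' - A| = (n%:R ^+ 2 * `|w' - A|) * rho by ring.
  by rewrite ler_wpM2r// ltW.
have h1 := Cauchy_Schwarz (q - w' *m y') w; rewrite dotBl in h1.
have h2 : enorm (q - w' *m y') * enorm w <= (1 - t) * rho * enorm w.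
  by rewrite ler_wpM2r// ltW.
have h3 : dot q w = rho * enorm w.
  by rewrite dotZl -sqr_enorm expr2 mulrA divfK// gt_eqF.
have h4 := Cauchy_Schwarz z w.
have h5 : enorm z * enorm w <= t * rho * enorm w by rewrite ler_wpM2r// ltW.
by lra.
Qed.

Lemma mean_legendre_exact y (d t : R) : 0 <= t < 1 ->
  (mean_legendre y <= d%:E)%E ->
  exists i, forall z, enorm z <= t * enorm y ->
    forall w, ((dot z w - f i z)%:E <= psi w)%E.
Proof.
move=> t01 yd; have /andP[t0 t1] := t01.
have [y0|yn0] := eqVneq (enorm y) 0.
  by rewrite y0 mulr0; apply: (@tconj_exact 0 s b) => // z w e; exact: small_le.
have y0 : 0 < enorm y by rewrite lt0r yn0 enorm_ge0.
(* Half of the margin [1 - t] goes to the bound on the conjugate, the other half to exactness of the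
   truncation. *)
have t'01 : 0 <= (1 + t) / 2 < 1 by lra.
have [c cP] := mean_legendre_bound y0 t'01 yd.
apply: (tconj_exact _ _ cP); first by rewrite mulr_ge0// ltW.
by rewrite ltr_pM2r//; lra.
Qed.

Lemma iter_liminf x (x_ : nat -> 'cV[R]_n) (c : R) : x_ @ \oo --> x ->
  (c%:E < symmetrization x)%E -> \forall k \near \oo, (c%:E <= psi_ k (x_ k))%E.
Proof.
move=> xx /(legendre_lt mean_legendre_gtNy)[y [d [yd cd]]].
have yd' : (mean_legendre y <= d%:E)%E by rewrite yd.
pose e := dot x y - d - c.
have e0 : 0 < e by rewrite /e; lra.
(* Shrinking [y] by [t] costs at most [e / 2] in the pairing with [x]; the minimum keeps
   [t >= 0]. *)
pose t := 1 - Num.min 1 (e / 2 / (`|dot x y| + 1)).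
have xy1 : 0 < `|dot x y| + 1 by rewrite ltr_wpDl.
have t01 : 0 <= t < 1.
  rewrite /t subr_ge0 ge_min lexx /= gtrBl lt_min ltr01 /=.
  by rewrite !divr_gt0.
have te : dot x y - t * dot x y <= e / 2.
  have -> : dot x y - t * dot x y = (1 - t) * dot x y by ring.
  have tt : 0 <= 1 - t by lra.
  apply: (@le_trans _ _ ((1 - t) * (`|dot x y| + 1))).
    by rewrite ler_wpM2l// (le_trans (ler_norm _))// lerDl.
  by rewrite -ler_pdivlMr// /t opprB addrC subrK ge_min lexx orbT.
have [i iP] := mean_legendre_exact t01 yd'.
pose p := t *: y.
have pr : enorm p <= t * enorm y.
  by rewrite /p enormZ ger0_norm//; case/andP: t01.
have low k : ((dot p (x_ k) - lavg r (f i) k p)%:E <= psi_ k (x_ k))%E.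
  exact: (iter_dual_le iP).
have lim : dot p (x_ k) - lavg r (f i) k p @[k --> \oo] --> dot p x - Fm i p.
  by apply: cvgB; [exact: (cvg_comp _ _ xx (@dot_continuousr R n p x))|exact: cvgF].
have cl : c < dot p x - Fm i p.
  have : Fm i p <= Fm i y by apply: Fm_shrink; lra.
  have := Fm_le_fin i yd'; rewrite /p dotZl (dotC y x) /e in te *; lra.
apply: (filterS _ (cvgr_gt _ lim _ cl)) => k ck.
by apply: le_trans (low k); rewrite lee_fin ltW.
Qed.

(* The minimizer [z] of [psi_ k + l * |. - x|^2] has the dual certificate
   [p = 2 l (x - z)], so a lower bound for the conjugate at [p] is an upper bound
   for [psi_ k z]. *)
Lemma iter_recovery x (al e : R) : symmetrization x = al%:E -> 0 < e ->
  \forall k \near \oo, exists z, enorm (z - x) <= e /\ (psi_ k z <= (al + e)%:E)%E.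
Proof.
move=> xal e0.
(* Chosen so that [2 l |x - z|^2 <= |al + e + b| + 1] means [|x - z| <= e]. *)
pose l := (`|al + e + b| + 1) / (2 * e ^+ 2).
have e20 : 0 < 2 * e ^+ 2 by rewrite mulr_gt0// exprn_gt0.
have l0 : 0 < l by rewrite divr_gt0// ltr_wpDl.
(* [D], [Q] and [rho] bound [|w - x|^2], [|z - x|^2] and the norm of the certificate for every [k],
   so near-attainment is needed only on one compact ball of slopes. *)
pose D := (enorm x0 + enorm x) ^+ 2.
have D0 : 0 <= D by rewrite sqr_ge0.
pose Q := (a + b + l * D) / l.
pose rho := 2 * l * Num.sqrt Q.
pose P k p := exists w d, psi_ k w = d%:E /\ dot p x - (al + e) < dot p w - d.
have nearP : \forall k \near \oo, [set p | enorm p <= rho] `<=` P k.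
  have /compact_near_coveringP cK := @compact_eball R n rho.
  apply: cK => p _.
  have hp : ((dot p x - (al + e / 2))%:E < mean_legendre p)%E.
    have : ((dot p x - al)%:E <= mean_legendre p)%E.
      by rewrite dotC; apply: Fenchel_Young; rewrite -/symmetrization xal.
    by apply: lt_le_trans; rewrite lte_fin; lra.
  have [i ci] := mean_legendre_lt hp.
  have := cvgr_gt _ (@cvgF i p) _ ci => -[K _ KP].
  (* Within [eps] of [p], the common Lipschitz constant [N i] of the averages and the change of
     [<p, x>] together cost at most [e / 2]. *)
  pose eps := e / 2 / (N i + enorm x + 1).
  have Nx : 0 < N i + enorm x + 1 by have := N0 i; have := enorm_ge0 x; lra.
  have eps0 : 0 < eps by rewrite !divr_gt0.
  exists ([set q | enorm (q - p) < eps], [set k | (K <= k)%N]).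
    split=> /=; last by exists K.
    apply: open_nbhs_nbhs; split; last by rewrite /= subrr enorm0.
    have -> : [set q | enorm (q - p) < eps] =
        (fun q : 'cV[R]_n => enorm (q - p)) @^-1` [set t | t < eps] by [].
    by apply: open_comp => [z _|]; [exact: enormB_continuous|exact: open_lt].
  move=> [q k] /= [qp Kk].
  have base z c' : c' < f i z -> exists w d, psi w = d%:E /\ c' < dot z w - d.
    by move=> /(tconj_lt x0a (x0N i))[w [d [_ wd cd]]]; exists w, d.
  suff /(iter_dual_lt base) : dot q x - (al + e) < lavg r (f i) k q by [].
  have := KP k Kk; rewrite /= => h1.
  have := lavg_lip Or (lf i) k p q; rewrite -(opprB q p) enormN.
  rewrite ler_norml => /andP[_ h2].
  have h3 := Cauchy_Schwarz (q - p) x; rewrite dotBl in h3.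
  have h4 : enorm (q - p) * (N i + enorm x + 1) <= e / 2.
    by rewrite -ler_pdivlMr// ltW.
  by have := enorm_ge0 (q - p); lra.
apply: filterS nearP => k kP.
have [w [c [wx0 wc ca]]] := iter_point k.
have [psik0 cpsi lpsi _ _] := iter_Conv_c k.
have kb := growth_ge s0 (iter_growth k).
have [z [d [zd zmin zP]]] := prox x cpsi lpsi kb wc l0.
have bd : - b <= d by have := kb z; rewrite zd lee_fin.
have wD : dot (w - x) (w - x) <= D.
  rewrite -sqr_enorm /D ler_pXn2r ?nnegrE ?addr_ge0 ?enorm_ge0//.
  by apply: (le_trans (ler_enormD _ _)); rewrite enormN lerD2r.
have zQ : dot (z - x) (z - x) <= Q.
  rewrite ler_pdivlMr//.
  have : l * dot (w - x) (w - x) <= l * D by rewrite ler_wpM2l// ltW.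
  by lra.
pose p := (2 * l) *: (x - z).
have prho : enorm p <= rho.
  have ll : 0 <= 2 * l by apply: mulr_ge0 => //; exact: ltW.
  rewrite /p enormZ (ger0_norm ll) /rho ler_wpM2l// -(opprB z x) enormN.
  exact: ler_wsqrtr.
have [w' [d' [w'd hd']]] := kP p prho.
have := zP w'; rewrite w'd lee_fin => h1.
have : d + 2 * l * dot (x - z) (x - z) < al + e.
  have E1 : dot p w' = 2 * l * dot (x - z) w' by rewrite dotZl.
  have E2 : dot p x = 2 * l * dot (x - z) x by rewrite dotZl.
  rewrite E1 E2 in hd'; move: h1; rewrite !dotBr; lra.
move=> h2; have q0 := dot_ge0 (x - z).
have lq0 : 0 <= l * dot (x - z) (x - z) by rewrite mulr_ge0// ltW.
exists z; split; last by rewrite zd lee_fin; lra.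
rewrite -(@ler_pXn2r _ 2) ?nnegrE ?enorm_ge0 ?(ltW e0)// sqr_enorm.
rewrite -(opprB x z) dotNl dotNr opprK.
have h3 : 2 * l * dot (x - z) (x - z) <= `|al + e + b| + 1.
  by have := ler_norm (al + e + b); lra.
have h4 : 0 < `|al + e + b| + 1 by rewrite ltr_wpDl.
have h5 : 2 * l * e ^+ 2 = `|al + e + b| + 1.
  by rewrite /l; field; rewrite gt_eqF.
have : 2 * l * dot (x - z) (x - z) <= 2 * l * e ^+ 2 by rewrite h5.
by rewrite ler_pM2l// mulr_gt0.
Qed.

(** Recovery points exist for each tolerance only from some step on; choosing [x_ k] almost optimal
    for the infimum of the admissible tolerances at step [k] gives one sequence for all of them. *)
Lemma iter_epi_converges : epi_converges psi_ symmetrization.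
Proof.
move=> x; split=> [x_ xx|].
  rewrite leNgt; apply/negP => hlt.
  have [c [cl cx]] : exists c : R,
      (limn_einf (fun k => psi_ k (x_ k)) < c%:E)%E /\ (c%:E < symmetrization x)%E.
    move: hlt; case: (limn_einf _) => [t| |]; last 2 first.
    - by rewrite ltNge leey.
    - case: (symmetrization x) => [t| |]// _; last by exists 0; rewrite ltNyr ltry.
      by exists (t - 1); rewrite ltNyr lte_fin; split=> //; lra.
    by move=> /EFin_lt_mid[c tc cx]; exists c; rewrite lte_fin.
  have [K _ KP] := iter_liminf xx cx.
  move: cl; rewrite ltNge => /negP; apply.
  have -> : limn_einf (fun k => psi_ k (x_ k)) =
      ereal_sup (range (einfs (fun k => psi_ k (x_ k)))).
    by rewrite limn_einf_lim; apply/cvg_lim => //; exact: cvg_einfs_sup.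
  apply: le_ereal_sup_tmp; exists (einfs (fun k => psi_ k (x_ k)) K).
    by exists K.
  by apply: le_ereal_inf_tmp => _ [k /= Kk <-]; exact: KP.
have [SgtNy _ _ _ _] := symmetrization_Conv_c.
move: (SgtNy x); case xal : (symmetrization x) => [al| |]// _; last first.
  (* Where the limit is [+oo], the liminf bound for the constant sequence is already the required
     convergence. *)
  exists (fun=> x); first exact: cvg_cst.
  apply/cvgeyPge => A; apply: (@iter_liminf x); first exact: cvg_cst.
  by rewrite xal ltry.
pose S k := [set e : R | 0 <= e /\
  exists z, enorm (z - x) <= e /\ (psi_ k z <= (al + e)%:E)%E].
have Slb k : has_lbound (S k) by exists 0 => e [].
have Sn0 k : S k !=set0.
  have [w [c [_ wc _]]] := iter_point k.
  exists (enorm (w - x) + `|c - al|); split.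
    by rewrite addr_ge0 ?enorm_ge0.
  exists w; split; first by rewrite lerDl.
  rewrite wc lee_fin; have := ler_norm (c - al); have := enorm_ge0 (w - x); lra.
have S_ex k : exists z, exists2 e, S k e & [/\ enorm (z - x) <= e,
    (psi_ k z <= (al + e)%:E)%E & e < inf (S k) + k.+1%:R^-1].
  have k0 : 0 < k.+1%:R^-1 :> R by rewrite invr_gt0 ltr0n.
  have [e Se einf] := inf_adherent k0 (conj (Sn0 k) (Slb k)).
  by have [_ [z [zx zal]]] := Se; exists z, e.
have [x_ x_P] := choice S_ex.
have small e : 0 < e -> \forall k \near \oo, enorm (x_ k - x) <= e /\
    (psi_ k (x_ k) <= (al + e)%:E)%E.
  move=> e0; have e20 : 0 < e / 2 by rewrite divr_gt0.
  have h1 := iter_recovery xal e20.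
  have h2 := near_infty_natSinv_lt (PosNum e20).
  apply: filterS2 h1 h2 => k [z [zx zal]] /= ke.
  have [e' _ [x1 x2 x3]] := x_P k.
  have : inf (S k) <= e / 2.
    by apply: ge_inf => //; split; [exact: ltW|exists z].
  move=> ie; have e'e : e' <= e by move: ke x3 ie; set u := _^-1; lra.
  split; first exact: le_trans e'e.
  by apply: (le_trans x2); rewrite lee_fin lerD2l.
have x_x : x_ @ \oo --> x.
  apply/cvgrPdist_le => e /small; apply: filterS => k [h _].
  by rewrite distrC; apply: le_trans h; exact: ler_norm_enorm.
exists x_ => //.
have low e : 0 < e -> \forall k \near \oo, ((al - e)%:E <= psi_ k (x_ k))%E.
  by move=> e0; apply: (iter_liminf x_x); rewrite xal lte_fin; lra.
have fin : \forall k \near \oo, psi_ k (x_ k) \is a fin_num.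
  have := small 1 ltr01; apply: filterS => k [_ h].
  have := iter_gtNy k (x_ k); move: h.
  by case: (psi_ k (x_ k)).
apply/fine_cvgP; split=> //; apply/cvgrPdist_le => e e0.
apply: filterS3 fin (low e e0) (small e e0) => k fk lk [_ sk] /=.
by move: lk sk; rewrite -{1 2}(fineK fk) !lee_fin ler_norml; lra.
Qed.

End Limit.

Theorem theorem4p1 (R : realType) (n m : nat) (hm : (0 < m)%N)
    (eta : probability (borel_matrix R n) R) (heta : haar_probability eta)
    (psi : 'cV[R]_n -> \bar R) (hpsi : Conv_c psi)
    (u : 'I_m -> 'cV[R]_n) (hu : forall i, enorm (u i) = 1)
    (hgen : closed_subgroup_generated [set refl_mx (u i) | i in setT]
            = orthogonal_group)
    (psi_ : nat -> 'cV[R]_n -> \bar R)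
    (psi_0 : psi_ 0%N = psi)
    (psi_S : forall k : nat,
       psi_ k.+1 = minkowski_symmetral (u (Ordinal (ltn_pmod k hm))) (psi_ k)) :
  (forall k, Conv_c (psi_ k)) /\
  exists psi_sym : 'cV[R]_n -> \bar R,
    unique (fun phi : 'cV[R]_n -> \bar R =>
      [/\ Conv_c phi, radial phi &
          forall x : 'cV[R]_n,
            legendre phi x
            = (\int[eta]_(t in orthogonal_group)
                 legendre psi (invmx t *m x))%E])
      psi_sym
    /\ epi_converges psi_ psi_sym.
Proof.
have [s [b [s0 psi_growth]]] := Conv_c_growth hpsi.
have [psi_gtNy _ _ [x0 x0fin] _] := hpsi.
have [a x0a] : exists a, psi x0 = a%:E.
  by move: (psi_gtNy x0) x0fin; case: (psi x0) => [a| |]//; exists a.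
pose v k := u (Ordinal (ltn_pmod k hm)); pose r k := refl_mx (v k).
have Or k : orthogonal_group (r k) by apply: orthogonal_refl; exact: hu.
have perr k : r (m + k)%N = r k.
  by rewrite /r /v; do 2 f_equal; apply: val_inj; rewrite /= modnDl.
have symr k : (r k)^T = r k by exact: refl_mx_tr.
have genr : closed_subgroup_generated (range r) = orthogonal_group.
  rewrite -hgen; congr closed_subgroup_generated; apply/seteqP; split.
    by move=> _ [k _ <-]; exists (Ordinal (ltn_pmod k hm)).
  move=> _ [i _ <-]; exists (i : nat) => //; rewrite /r /v; do 2 f_equal.
  by apply: val_inj; rewrite /= modn_small.
have v1 k : enorm (v k) = 1 by exact: hu.
split; first exact: (iter_Conv_c s0 psi_growth v1 hpsi psi_0 psi_S).
exists (symmetrization eta psi); split; last first.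
  exact: (iter_epi_converges heta Or hm perr symr genr x0a s0 psi_growth v1
    (fun=> erefl) hpsi psi_0 psi_S).
split; first split.
- exact: (symmetrization_Conv_c heta Or hm perr symr genr x0a s0 psi_growth).
- exact: (symmetrization_radial heta Or hm perr symr genr x0a s0 psi_growth).
- by move=> x; rewrite (legendre_symmetrization heta Or hm perr symr genr x0a s0
    psi_growth).
- move=> phi [phiC _ phiE].
  by apply: (symmetrization_unique phiC); apply/funext.
Qed.
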